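(* Let $n \geq 1$ be an integer, let $Y$ be a separable arc-wise connected metric space in $\mathbb{R}^{n}$ (a subset of $\mathbb{R}^n$ with the Euclidean metric), let $\xi \geq 1$ be an ordinal, let $f: H \rightarrow Y$ be a function of Baire class $\xi + n - 1(H, Y)$, let $E$ be a subset of $X$, and let $\varphi: E \rightarrow Y$ be a boundary function for $f$. Then $\varphi$ is of Baire class $\xi + n(E, Y)$.
   Context: $H$ denotes the (open) upper half-plane in $\mathbb{R}^2$, and $X$ denotes its frontier, the $x$-axis. For $x \in X$, an arc at $x$ is a simple arc $\gamma$ with one endpoint at $x$ such that $\gamma - \{x\} \subseteq H$. For a function $f: H \to Y$ into a metric space $Y$ and a subset $E \subseteq X$, a function $\varphi: E \to Y$ is a boundary function for $f$ if and only if for each $x \in E$ there exists an arc $\gamma$ at $x$ such that $\lim_{z \to x,\ z \in \gamma} f(z) = \varphi(x)$ (the limit being taken over $z \in \gamma - \{x\}$, where $f$ is defined). Baire classes: for metric spaces $M$ and $Y$, a function $g: M \to Y$ is of Baire class $0(M,Y)$ if and only if it is continuous. For an ordinal $\alpha \geq 1$, $g$ is of Baire class $\alpha(M,Y)$ if and only if there is a sequence $\{g_k\}_{k=1}^{\infty}$ of functions $M \to Y$, with $g_k$ of Baire class $\eta_k(M,Y)$ for some $\eta_k < \alpha$, such that $g_k \to g$ pointwise. ''Baire class $\xi+n-1(H,Y)$'' means Baire class $\alpha(H,Y)$ with $\alpha = \xi+(n-1)$, and ''Baire class $\xi+n(E,Y)$'' means Baire class $\alpha(E,Y)$ with $\alpha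 = \xi+n$, where $E$ carries the metric inherited from $X$. *)

(* Defs.v *)
From HB Require Import structures.
From mathcomp Require Import all_boot all_order all_algebra.
From mathcomp Require Import all_classical all_reals all_analysis.
Set Implicit Arguments.
Unset Strict Implicit.
Unset Printing Implicit Defensive.
Import Order.TTheory GRing.Theory Num.Theory.
Import numFieldNormedType.Exports.
Local Open Scope classical_set_scope.
Local Open Scope ring_scope.

(* [osup a] denotes the least ordinal strictly above every [a i].  Distinct
   trees may denote the same ordinal, so ordinals are compared by [ord_le] and
   [ord_lt], never by Leibniz equality.  The lemmas below show that [ord_lt]
   well-orders the ordinals up to [ord_le]-equivalence and that every family
   of ordinals indexed by a type has [osup] as its least strict upper bound. *)
Inductive ordinal_number : Type := osup (I : Type) (a : I -> ordinal_number).

Fixpoint ord_le (x y : ordinal_number) : Prop :=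
  match x, y with
  | osup U a, osup V b => forall i, exists j, ord_le (a i) (b j)
  end.

Definition ord_lt (x y : ordinal_number) : Prop :=
  match y with osup V b => exists j, ord_le x (b j) end.

Definition ord_zero : ordinal_number :=
  osup (fun v : void => match v with end).

Definition ord_succ (x : ordinal_number) : ordinal_number :=
  osup (fun _ : unit => x).

Definition ord_addn (x : ordinal_number) (n : nat) : ordinal_number :=
  iter n ord_succ x.

Lemma ord_le_refl x : ord_le x x.
Proof. by elim: x => U a IH /= i; exists i. Qed.

Lemma ord_le_trans y x z : ord_le x y -> ord_le y z -> ord_le x z.
Proof.
elim: x y z => U a IH [V b] [W c] /= ab bc i.
have [j aibj] := ab i; have [k bjck] := bc j.
by exists k; exact: IH aibj bjck.
Qed.

Lemma ord_le_lt_trans y x z : ord_le x y -> ord_lt y z -> ord_lt x z.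
Proof. by case: z => W c xy [k yk]; exists k; exact: ord_le_trans yk. Qed.

Lemma osup_leP (I : Type) (a : I -> ordinal_number) y :
  ord_le (osup a) y <-> forall i, ord_lt (a i) y.
Proof. by case: y => V b. Qed.

Lemma ord_lt_sup (I : Type) (a : I -> ordinal_number) i : ord_lt (a i) (osup a).
Proof. by exists i; exact: ord_le_refl. Qed.

Lemma ord_le_total x y : ord_le x y \/ ord_lt y x.
Proof.
elim: x y => U a IH y; have [h|] := pselect (forall i, ord_lt (a i) y).
  by left; apply/osup_leP.
move=> /existsNP[i nai]; right; exists i.
case: y nai => V b nai; apply/osup_leP => j.
by have [aibj|//] := IH i (b j); case: nai; exists j.
Qed.

Lemma ord_lt_wf : well_founded ord_lt.
Proof.
suff h x y : ord_le y x -> Acc ord_lt y.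
  by move=> x; apply: (h x); exact: ord_le_refl.
elim: x y => U a IH y yx; constructor => z zy.
have [i zi] : ord_lt z (osup a).
  case: y yx zy => V b ba [j zj]; have [i bi] := ba j.
  by exists i; exact: ord_le_trans bi.
exact: IH zi.
Qed.

Lemma ord_lt_succ x y : ord_lt x (ord_succ y) <-> ord_le x y.
Proof. by split=> [[]|xy] //; exists tt. Qed.

(* [M] and [Y] are subsets of ambient spaces: a function M -> Y is a total
   function of the ambient spaces mapping [M] into [Y], whose values outside
   [M] are irrelevant. *)
Inductive baire_class (S T : topologicalType) (M : set S) (Y : set T) :
    ordinal_number -> (S -> T) -> Prop :=
| baire_class0 (alpha : ordinal_number) (g : S -> T) :
    ord_le alpha ord_zero ->
    set_fun M Y g ->
    {within M, continuous g} ->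
    baire_class M Y alpha g
| baire_class_lim (alpha : ordinal_number) (g : S -> T)
    (eta : nat -> ordinal_number) (h : nat -> S -> T) :
    ord_le (ord_succ ord_zero) alpha ->
    set_fun M Y g ->
    (forall k, ord_lt (eta k) alpha) ->
    (forall k, baire_class M Y (eta k) (h k)) ->
    (forall x, M x -> h k x @[k --> \oo] --> g x) ->
    baire_class M Y alpha g.

Definition upper_half_plane (R : realType) : set (R * R) :=
  [set z | 0 < z.2].

Definition x_axis (R : realType) : set (R * R) := [set z | z.2 = 0].

(* On the compact interval [0, 1], a continuous injection into a Hausdorff
   space is a homeomorphism onto its image. *)
Definition simple_arc (R : realType) (T : topologicalType)
    (A : set T) (p q : T) : Prop :=
  exists c : R -> T,
    [/\ {within `[0, 1], continuous c}, set_inj `[0, 1] c,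
        c @` `[0, 1] = A, c 0 = p & c 1 = q].

Definition arc_at (R : realType) (x : R * R) (A : set (R * R)) : Prop :=
  (exists q, simple_arc R A x q) /\ A `\ x `<=` @upper_half_plane R.

Definition boundary_function (R : realType) (T : topologicalType)
    (f : R * R -> T) (E : set (R * R)) (phi : R * R -> T) : Prop :=
  forall x, E x -> exists2 A, arc_at x A &
    f z @[z --> within (A `\ x) (nbhs x)] --> phi x.

Definition separable_set (T : topologicalType) (Y : set T) : Prop :=
  exists D, [/\ countable D, D `<=` Y & Y `<=` closure D].

Definition arcwise_connected (R : realType) (T : topologicalType)
    (Y : set T) : Prop :=
  forall p q, Y p -> Y q -> p <> q ->
    exists2 A, simple_arc R A p q & A `<=` Y.

(* Main.v *)
Require Import Defs.
From HB Require Import structures.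
From mathcomp Require Import all_boot all_order all_algebra.
From mathcomp Require Import all_classical all_reals all_analysis.
From mathcomp Require Import lra.
Set Implicit Arguments.
Unset Strict Implicit.
Unset Printing Implicit Defensive.
Import Order.TTheory GRing.Theory Num.Theory.
Import numFieldNormedType.Exports.
Local Open Scope classical_set_scope.
Local Open Scope ring_scope.

(** Let [alpha >= 1] be the class of [f].  The point is to move 0-1 valued
    functions of class [alpha] from the half-plane to the boundary without
    raising the class; one pointwise limit then gives [phi].

    Take first a real valued [f] and [a < b].  There is a 0-1 valued [h] of
    class [alpha] on the half-plane that is 0 where [f <= a] and 1 where
    [f >= b] ([baire_separate]).  If [phi x < a], then [h] is 0 on the arc at
    [x] near [x]; if [b < phi x], it is 1 there.  Fix a height [r] and look at
    the arcs which climb to height [r] inside one of the sets [h = 0] and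
    [h = 1].  Two arcs of different colours are disjoint, and disjoint paths in
    a strip cannot exchange their order ([paths_cross], [stem_order]), so at
    height [r] they are met in the order of their feet.  Arcs of the same
    colour may cross, but this disorder is confined to runs of feet of one
    colour, and letting all feet of such a run share a single arc produces a
    nondecreasing [q] for which [h (q x, r)] is the colour of [x]
    ([monotone_selection], [level_map]).  As [q] is continuous off a countable
    set, [h (q x, r)] agrees off that set with a 0-1 valued function of class
    [alpha] on the line ([binary_extend]).  Taking [r = 1 / (n + 1)] and
    correcting at stage [n] the values at the first [n] exceptional points, one
    gets 0-1 valued functions of class [alpha] which at each point of [E] are
    eventually 0 if [phi < a] and eventually 1 if [phi > b]
    ([boundary_separate]).

    For a general [Y] these tests are applied to the distances from [f] to the
    points of a dense sequence [y].  At stage [m] the first [m] tests give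
    finitely many bits, which are of class [alpha]; from them an index [i <= m]
    is selected such that [y i] is compatible with as many initial tests as
    possible.  Since each test is eventually reliable, the selected points
    converge to [phi].  The selected index is a real function of class [alpha]
    with values in [0, ..., m], and composing it with a path in [Y] that passes
    through [y 0, ..., y m] at the times [0, ..., m] keeps the class and stays
    in [Y]: this is where arcwise connectedness enters
    ([baire_boundary_succ]). *)

(** * Ordinals and Baire classes *)

Notation ord_one := (ord_succ ord_zero).

Lemma ord_lt_succ_le x y : ord_lt x y <-> ord_le (ord_succ x) y.
Proof.
split=> [xy|/osup_leP/(_ tt)//].
by apply/osup_leP.
Qed.

Lemma ord_lt_le_trans y x z : ord_lt x y -> ord_le y z -> ord_lt x z.
Proof.
by move=> /ord_lt_succ_le xy yz; apply/ord_lt_succ_le; exact: ord_le_trans yz.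
Qed.

Lemma ord_ltW x y : ord_lt x y -> ord_le x y.
Proof.
elim: x y => U a IH y xy; apply/osup_leP => i.
case: y xy => V b [j xb]; exists j; apply: IH.
exact: ord_lt_le_trans (ord_lt_sup a i) xb.
Qed.

Lemma ord_zero_le x : ord_le ord_zero x.
Proof. by apply/osup_leP; case. Qed.

Lemma ord_one_gt0 : ord_lt ord_zero ord_one.
Proof. by apply/ord_lt_succ; exact: ord_le_refl. Qed.

Lemma ord_zero_or_pos x : ord_le x ord_zero \/ ord_le ord_one x.
Proof.
by have [|/ord_lt_succ_le] := ord_le_total x ord_zero; [left|right].
Qed.

Lemma ord_le_addn x n : ord_le x (ord_addn x n).
Proof.
elim: n => [|n IH]; first exact: ord_le_refl.
apply: ord_le_trans IH _; apply: ord_ltW; apply/ord_lt_succ.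
exact: ord_le_refl.
Qed.

Lemma ord_max_lt alpha x y : ord_lt x alpha -> ord_lt y alpha ->
  exists z, [/\ ord_lt z alpha, ord_le x z & ord_le y z].
Proof.
move=> xa ya; have [?|le] := ord_le_total x y.
  by exists y; split => //; exact: ord_le_refl.
exists x; split => //; first exact: ord_le_refl.
exact: ord_ltW.
Qed.

Section BaireGeneral.
Variables (S T : topologicalType).
Implicit Types (M : set S) (Y : set T).

Lemma baire_class_continuous M Y alpha g :
  ord_le alpha ord_zero -> baire_class M Y alpha g -> {within M, continuous g}.
Proof.
move=> a0 bg; case: bg a0 => // {}alpha {}g eta h a1 _ _ _ _ a0.
have [v] : ord_lt ord_zero ord_zero.
  exact: ord_lt_le_trans ord_one_gt0 (ord_le_trans a1 a0).
by case: v.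
Qed.

(** When [beta > 0] a continuous function enters class [beta] as the limit of
    a constant sequence. *)
Lemma baire_class_mono M Y alpha beta g :
  ord_le alpha beta -> baire_class M Y alpha g -> baire_class M Y beta g.
Proof.
move=> ab bg; case: bg ab => [{}alpha {}g a0 fg cg|{}alpha {}g eta h a1 fg ea bh hg] ab.
- have [b0|b1] := ord_zero_or_pos beta; first exact: baire_class0.
  apply: (@baire_class_lim _ _ _ _ _ _ (fun=> ord_zero) (fun=> g)) => //.
  + by move=> _; exact/ord_lt_succ_le.
  + by move=> _; apply: baire_class0 => //; exact: ord_le_refl.
  + by move=> x Mx; exact: cvg_cst.
- apply: (@baire_class_lim _ _ _ _ _ _ eta h) => //.
  + exact: ord_le_trans ab.
  + by move=> k; exact: ord_lt_le_trans ab.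
Qed.

(** For [alpha > 0] both constructors take the shape of a limit, which spares
    the case of a continuous function in later inductions. *)
Lemma baire_class_posE M Y alpha g : ord_le ord_one alpha ->
  baire_class M Y alpha g ->
  exists eta h, [/\ forall k, ord_lt (eta k) alpha,
    forall k, baire_class M Y (eta k) (h k) &
    forall x, M x -> h k x @[k --> \oo] --> g x].
Proof.
move=> a1 bg; case: bg a1 => [{}alpha {}g a0 fg cg a1|{}alpha {}g eta h a1 fg ea bh hg _].
- exists (fun=> ord_zero), (fun=> g); split.
  + by move=> _; exact/ord_lt_succ_le.
  + by move=> _; apply: baire_class0 => //; exact: ord_le_refl.
  + by move=> x Mx; exact: cvg_cst.
- by exists eta, h.
Qed.

Lemma baire_class_cst M Y alpha c : Y c -> baire_class M Y alpha (fun=> c).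
Proof.
move=> Yc; apply: (baire_class_mono (ord_zero_le alpha)).
apply: baire_class0; [exact: ord_le_refl|by move=> x Mx|].
by apply/subspace_continuousP => x Mx; exact: cvg_cst.
Qed.

Lemma baire_class_eq M Y alpha f g : (forall x, M x -> f x = g x) ->
  baire_class M Y alpha f -> baire_class M Y alpha g.
Proof.
move=> fg bf; case: bf fg => [{}alpha {}f a0 ff cf|{}alpha {}f eta h a1 ff ea bh hf] fg.
- apply: baire_class0 => //; first by move=> x Mx; rewrite -fg//; exact: ff.
  apply: (subspace_eq_continuous _ cf) => x; rewrite inE; exact: fg.
- apply: (@baire_class_lim _ _ _ _ _ _ eta h) => //.
    by move=> x Mx; rewrite -fg//; exact: ff.
  by move=> x Mx; rewrite -fg//; exact: hf.
Qed.

End BaireGeneral.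

Lemma baire_class_comp (S T U : topologicalType) (M : set S) (Y : set T)
    (Z : set U) (c : T -> U) alpha g :
  continuous c -> set_fun Y Z c -> baire_class M Y alpha g ->
  baire_class M Z alpha (c \o g).
Proof.
move=> cc YZ; elim=> {alpha g} [alpha g a0 fg cg|alpha g eta h a1 fg ea bh IH hg].
- apply: baire_class0 => //; first by move=> x Mx; apply: YZ; exact: fg.
  move/subspace_continuousP : cg => cg.
  apply/subspace_continuousP => x Mx.
  by apply: continuous_cvg; [exact: cc|exact: cg].
- apply: (@baire_class_lim _ _ _ _ _ _ eta (fun k => c \o h k)) => //.
    by move=> x Mx; apply: YZ; exact: fg.
  by move=> x Mx; apply: continuous_cvg; [exact: cc|exact: hg].
Qed.

Lemma baire_class_precomp (S S' T : topologicalType) (M : set S) (M' : set S')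
    (Y : set T) (p : S' -> S) alpha g :
  continuous p -> set_fun M' M p -> baire_class M Y alpha g ->
  baire_class M' Y alpha (g \o p).
Proof.
move=> cp MM; elim=> {alpha g} [alpha g a0 fg cg|alpha g eta h a1 fg ea bh IH hg].
- apply: baire_class0 => //; first by move=> x Mx; apply: fg; exact: MM.
  apply/subspace_continuousP => x Mx; apply: (@cvg_comp _ _ _ p g _ (within M (nbhs (p x)))).
    move=> A pA; have pA' : nbhs x (fun y => M (p y) -> A (p y)) := cp x _ pA.
    change (nbhs x (fun y => M' y -> A (p y))).
    by apply: filterS pA' => y + M'y; apply; exact: MM.
  by move/subspace_continuousP : cg; apply; exact: MM.
- apply: (@baire_class_lim _ _ _ _ _ _ eta (fun k => h k \o p)) => //.
    by move=> x Mx; apply: fg; exact: MM.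
  by move=> x Mx; apply: hg; exact: MM.
Qed.

(** All algebra of Baire classes goes through pairing: a continuous operation
    is then a mere composition, by [baire_class_comp]. *)
Lemma baire_class_pair (S T U : topologicalType) (M : set S) alpha
    (f : S -> T) (g : S -> U) :
  baire_class M setT alpha f -> baire_class M setT alpha g ->
  baire_class M setT alpha (fun x => (f x, g x)).
Proof.
elim/(well_founded_induction ord_lt_wf): alpha f g => alpha IH f g bf bg.
have [a0|a1] := ord_zero_or_pos alpha.
  move/(baire_class_continuous a0)/subspace_continuousP : bf => cf.
  move/(baire_class_continuous a0)/subspace_continuousP : bg => cg.
  apply: baire_class0 => //; apply/subspace_continuousP => x Mx.
  by apply: cvg_pair; [exact: cf|exact: cg].
have [eta [h [ea bh hf]]] := baire_class_posE a1 bf.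
have [eta' [h' [ea' bh' hg]]] := baire_class_posE a1 bg.
have [m mP] := choice (fun k => ord_max_lt (ea k) (ea' k)).
apply: (@baire_class_lim _ _ _ _ _ _ m (fun k x => (h k x, h' k x))) => //.
- by move=> k; have [] := mP k.
- move=> k; have [ma le le'] := mP k; apply: IH => //.
    exact: baire_class_mono (bh k).
  exact: baire_class_mono (bh' k).
- by move=> x Mx; apply: cvg_pair; [exact: hf|exact: hg].
Qed.

Section BaireReal.
Variables (R : realType) (S : topologicalType) (M : set S).
Implicit Types f g : S -> R.

Notation baire := (@baire_class S R M setT).

Lemma baireD alpha f g : baire alpha f -> baire alpha g ->
  baire alpha (fun x => f x + g x).
Proof.
move=> bf bg; have := baire_class_pair bf bg.
apply: (@baire_class_comp _ _ _ _ setT _ (fun z : R * R => z.1 + z.2)) => //.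
by move=> z; apply: cvgD; [exact: cvg_fst|exact: cvg_snd].
Qed.

Lemma baireM alpha f g : baire alpha f -> baire alpha g ->
  baire alpha (fun x => f x * g x).
Proof.
move=> bf bg; have := baire_class_pair bf bg.
apply: (@baire_class_comp _ _ _ _ setT _ (fun z : R * R => z.1 * z.2)) => //.
by move=> z; apply: cvgM; [exact: cvg_fst|exact: cvg_snd].
Qed.

Lemma baireN alpha f : baire alpha f -> baire alpha (fun x => - f x).
Proof.
move=> bf; apply: (@baire_class_comp _ _ _ _ setT _ (fun z : R => - z)) bf => //.
by move=> z; exact: oppr_continuous.
Qed.

Lemma baire_onem alpha f : baire alpha f -> baire alpha (fun x => 1 - f x).
Proof.
by move=> bf; apply: (baireD (f := fun=> 1)); [exact: baire_class_cst|exact: baireN].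
Qed.

(** Membership in the union of the classes below [alpha], which is closed under
    the operations that preserve every class although it is not itself a
    class when [alpha] is a limit. *)
Definition baire_below alpha g := exists2 eta, ord_lt eta alpha & baire eta g.

Lemma baire_below_lift2 alpha f g (op : (S -> R) -> (S -> R) -> S -> R) :
  (forall eta, baire eta f -> baire eta g -> baire eta (op f g)) ->
  baire_below alpha f -> baire_below alpha g -> baire_below alpha (op f g).
Proof.
move=> H [x xa bf] [y ya bg]; have [z [za xz yz]] := ord_max_lt xa ya.
by exists z => //; apply: H; [exact: baire_class_mono xz _|exact: baire_class_mono yz _].
Qed.

End BaireReal.

(** * Separation by 0-1 valued functions *)

Lemma near_forall_lt (N : nat) (P : nat -> nat -> Prop) :
  (forall l, (l < N)%N -> \forall m \near \oo, P l m) ->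
  \forall m \near \oo, forall l, (l < N)%N -> P l m.
Proof.
elim: N => [|N IH] H; first by near=> m => l.
have HN := H N (ltnSn N).
have /IH {}IH : forall l, (l < N)%N -> \forall m \near \oo, P l m.
  by move=> l lN; apply: H; exact: ltnW.
near=> m => l; rewrite ltnS leq_eqVlt => /predU1P[->|]; first by near: m.
by move: l; near: m.
Unshelve. all: by end_near. Qed.

Section BaireSelection.
Variables (R : realType) (S : topologicalType) (M : set S).
Implicit Types f g h : S -> R.

Notation baire := (@baire_class S R M setT).

(** Think of [w i k] as approximating, for [k] large, the indicator of the
    complement of a set [Z i], with the value 0 on [Z i] at every stage; the
    sets [Z i] cover [M].  Giving to [x] the label of the first [Z i] that
    contains it is then a limit: the recursive formula [F] for this first label
    stops at the first [i] with [w i k x = 0], hence stabilizes at [x] although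
    its length grows with [k]. *)
Lemma first_zero_label alpha (w : nat -> nat -> S -> R) (b : nat -> R) :
  ord_le ord_one alpha ->
  (forall i k, baire_below M alpha (w i k)) ->
  (forall x, M x -> forall i,
    (forall k, w i k x = 0) \/ \forall k \near \oo, w i k x = 1) ->
  (forall x, M x -> exists i, forall k, w i k x = 0) ->
  exists2 h, baire alpha h &
    forall x, M x -> exists2 i, (forall k, w i k x = 0) & h x = b i.
Proof.
move=> a1 bw w01 w0.
pose F k := fix F n i x : R := if n is n'.+1
  then (1 - w i k x) * b i + w i k x * F n' i.+1 x else 0.
have bF k n i : baire_below M alpha (F k n i).
  elim: n i => [|n IH] i.
    by exists ord_zero; [exact/ord_lt_succ_le|exact: baire_class_cst].
  apply: (baire_below_lift2 (op := fun f g x => (1 - f x) * b i + f x * g x)) => //.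
  move=> eta bf bg; apply: baireD; last exact: baireM.
  by apply: baireM; [exact: baire_onem|exact: baire_class_cst].
have limF x : exists v, M x ->
    (exists2 i, (forall k, w i k x = 0) & v = b i) /\
    F k k 0%N x @[k --> \oo] --> v.
  have [Mx|nMx] := pselect (M x); last by exists 0.
  have [i0 i0P i0min] : exists2 i, (forall k, w i k x = 0) &
      forall l, (l < i)%N -> \forall k \near \oo, w l k x = 1.
    have ex : exists i, `[< forall k, w i k x = 0 >].
      by have [i iP] := w0 x Mx; exists i; exact/asboolP.
    case: (ex_minnP ex) => i /asboolP iP imin; exists i => // l li.
    have [wl|//] := w01 x Mx l.
    by move: (imin l (asboolT wl)); rewrite leqNgt li.
  exists (b i0) => _; split; first by exists i0.
  apply: cvg_near_cst.
  have w1 := near_forall_lt i0min.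
  have Fb k n i : (forall l, (l < i0)%N -> w l k x = 1) ->
      (i <= i0 < i + n)%N -> F k n i x = b i0.
    move=> wk; elim: n i => [|n IH] i /andP[ii0 i0n] /=.
      by move: i0n; rewrite addn0 ltnNge ii0.
    move: ii0; rewrite leq_eqVlt => /predU1P[->|ii0].
      by rewrite i0P subr0 mul1r mul0r addr0.
    by rewrite wk// subrr mul0r add0r mul1r IH// ii0 addSnnS.
  near=> k; apply: Fb; first by near: k.
  by rewrite /= add0n; near: k; exact: nbhs_infty_gt.
have [h hP] := choice limF.
have /choice[eta etaP] k : exists e, ord_lt e alpha /\ baire e (F k k 0%N).
  by have [e] := bF k k 0%N; exists e.
exists h; last by move=> x /hP[].
apply: (@baire_class_lim _ _ _ _ _ _ eta (fun k => F k k 0%N)) => //.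
- by move=> k; have [] := etaP k.
- by move=> k; have [] := etaP k.
- by move=> x Mx; have [] := hP x Mx.
Unshelve. all: by end_near. Qed.

(** A continuous approximation, for [k] going to infinity, of the indicator of
    [t != 0] on nonnegative [t]; for each [t] it is eventually exact. *)
Definition saturate (k : nat) (t : R) : R := Num.min 1 (k%:R * t).

Lemma saturate_continuous k : continuous (saturate k).
Proof.
move=> t; rewrite -[saturate k]/((fun=> 1) \min ( *%R k%:R)).
apply: continuous_min; [exact: cst_continuous|exact: mulrl_continuous].
Qed.

Lemma saturate0 k : saturate k 0 = 0.
Proof. by rewrite /saturate mulr0; apply/min_idPr. Qed.

Lemma saturate_near1 (c : R) (t : nat -> R) : 0 < c ->
  (\forall k \near \oo, c <= t k) -> \forall k \near \oo, saturate k (t k) = 1.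
Proof.
move=> c0 ct; near=> k; apply/min_idPl.
have ck : c <= t k by near: k.
have k1 : c^-1 <= k%:R by near: k; exact: nbhs_infty_ger.
by rewrite -[leLHS](mulVf (lt0r_neq0 c0)) ler_pM ?invr_ge0 ?(ltW c0).
Unshelve. all: by end_near. Qed.

Lemma baire_saturate alpha k g : baire alpha g ->
  baire alpha (fun x => saturate k (g x)).
Proof.
by move=> bg; apply: (baire_class_comp (@saturate_continuous k)) bg.
Qed.

Lemma baire_below_sum alpha (n : nat) (f : nat -> S -> R) :
  ord_le ord_one alpha ->
  (forall i, (i < n)%N -> baire_below M alpha (f i)) ->
  baire_below M alpha (fun x => \sum_(i < n) f i x).
Proof.
move=> a1; elim: n => [|n IH] bf.
  exists ord_zero; first exact/ord_lt_succ_le.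
  apply: (@baire_class_eq _ _ _ _ _ (fun=> 0)); last exact: baire_class_cst.
  by move=> x _; rewrite big_ord0.
have -> : (fun x => \sum_(i < n.+1) f i x) = (fun x => \sum_(i < n) f i x + f n x).
  by apply/funext => x; rewrite big_ord_recr.
apply: (baire_below_lift2 (op := fun f g x => f x + g x)).
- by move=> eta; exact: baireD.
- by apply: IH => i ni; apply: bf; exact: ltnW.
- exact: bf.
Qed.

(** Write [g] as the limit of [u j] with [u j] of smaller class.  For
    [a < s < t < b] every point is in some set [forall j >= i, u j <= t] or
    [forall j >= i, s <= u j]; label the former 0, the latter 1 and take the
    label of the first set of the enumeration that contains the point.  Where
    [g <= a] the sets labelled 1 are absent, and symmetrically where
    [g >= b]. *)
Lemma baire_separate alpha g (a b : R) : ord_le ord_one alpha ->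
  baire alpha g -> a < b ->
  exists h, [/\ baire alpha h, forall x, M x -> h x = 0 \/ h x = 1,
    forall x, M x -> g x <= a -> h x = 0 &
    forall x, M x -> b <= g x -> h x = 1].
Proof.
move=> a1 bg ab; have [eta [u [ea bu ug]]] := baire_class_posE a1 bg.
pose s := a + (b - a) / 3; pose t := a + (b - a) * 2 / 3.
have [as_ st tb] : [/\ a < s, s < t & t < b] by split; rewrite /s /t; lra.
(* The index [i] encodes the pair of [i./2] and a label, the parity of [i];
   [c i r] is the defect of [r] with respect to the condition with label
   [odd i]. *)
pose c i (r : R) := if odd i then Num.max 0 (s - r) else Num.max 0 (r - t).
have c_ge0 i r : 0 <= c i r by rewrite /c; case: ifP => _; rewrite le_max lexx.
have cc i : continuous (c i).
  move=> r; rewrite /c; case: (odd i).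
    change {for r, continuous ((fun=> 0) \max (fun r => s - r))}.
    apply: continuous_max; first exact: cst_continuous.
    by apply: cvgB; [exact: cvg_cst|exact: cvg_id].
  change {for r, continuous ((fun=> 0) \max (fun r => r - t))}.
  apply: continuous_max; first exact: cst_continuous.
  by apply: cvgB; [exact: cvg_id|exact: cvg_cst].
pose v i k x := \sum_(j < k) (i./2 <= j)%N%:R * c i (u j x).
have v_ge0 i k x : 0 <= v i k x.
  by apply: sumr_ge0 => j _; rewrite mulr_ge0.
have [||||h bh hP] := @first_zero_label alpha
    (fun i k x => saturate k (v i k x)) (fun i => (odd i)%:R).
- exact: a1.
- move=> i k; have [e e_lt be] : baire_below M alpha (v i k).
    apply: (@baire_below_sum _ k (fun j x => (i./2 <= j)%N%:R * c i (u j x))) => // j _.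
    exists (eta j) => //; apply: baireM; first exact: baire_class_cst.
    exact: (baire_class_comp (@cc i)) (bu j).
  by exists e => //; exact: baire_saturate.
- move=> x Mx i.
  have [v0|/existsNP[k0 /eqP vk0]] := pselect (forall k, v i k x = 0).
    by left=> k; rewrite v0 saturate0.
  right; apply: (@saturate_near1 (v i k0 x)).
    by rewrite lt_def vk0 v_ge0.
  near=> k; have /subnK <- : (k0 <= k)%N by near: k; exact: nbhs_infty_ge.
  rewrite addnC /v big_split_ord /= lerDl.
  by apply: sumr_ge0 => j _; rewrite mulr_ge0.
- move=> x Mx.
  have ev (P : R -> Prop) : (\forall r \near g x, P r) ->
      exists N, forall j, (N <= j)%N -> P (u j x).
    by move=> /(ug x Mx)[N _ NP]; exists N => j Nj; exact: NP.
  have zero i : (forall j, (i./2 <= j)%N -> c i (u j x) = 0) ->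
      forall k, saturate k (v i k x) = 0.
    move=> ci k; rewrite /v big1 ?saturate0// => j _.
    by case: leqP => [/ci ->|_]; rewrite ?mulr0 ?mul0r.
  have [gt|tg] := ltP (g x) t.
    have [N NP] := ev _ (lt_nbhsl gt); exists N.*2; apply: zero => j.
    rewrite doubleK /c odd_double => /NP ut.
    by apply/max_idPl; rewrite subr_le0 ltW.
  have [N NP] := ev _ (lt_nbhsr (lt_le_trans st tg)); exists N.*2.+1; apply: zero => j.
  rewrite /= uphalf_double /c /= odd_double => /NP us.
  by apply/max_idPl; rewrite subr_le0 ltW.
have key x i : M x -> (forall k, saturate k (v i k x) = 0) ->
    \forall j \near \oo, c i (u j x) = 0.
  move=> Mx vi; near=> j.
  have ij : (i./2 <= j)%N by near: j; exact: nbhs_infty_ge.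
  apply/eqP; rewrite eq_le c_ge0 andbT.
  have := vi j.+1; rewrite /saturate => /eqP; rewrite minEle; case: ifP.
    by rewrite oner_eq0.
  rewrite mulf_eq0 pnatr_eq0 /= => _.
  rewrite /v big_ord_recr /= ij mul1r => /eqP.
  have : 0 <= \sum_(l < j) (i./2 <= l)%N%:R * c i (u l x).
    by apply: sumr_ge0 => l _; rewrite mulr_ge0.
  by move: (c_ge0 i (u j x)); lra.
exists h; split => //.
- by move=> x /hP[i _ ->]; case: (odd i); [right|left].
- move=> x Mx ga; have [i vi ->] := hP x Mx; case: (boolP (odd i)) => //= oi.
  have gs : g x < s by exact: le_lt_trans as_.
  have ev : \forall j \near \oo, u j x < s := ug x Mx _ (lt_nbhsl gs).
  have [j [/= us]] := filter_ex (filterI ev (key x i Mx vi)).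
  rewrite /c oi => /eqP; rewrite eq_le ge_max lexx /= subr_le0 le_max lexx andbT.
  by rewrite leNgt us.
- move=> x Mx bg'; have [i vi ->] := hP x Mx; case: (boolP (odd i)) => //= /negbTE oi.
  have gt : t < g x by exact: lt_le_trans bg'.
  have ev : \forall j \near \oo, t < u j x := ug x Mx _ (lt_nbhsr gt).
  have [j [/= us]] := filter_ex (filterI ev (key x i Mx vi)).
  rewrite /c oi => /eqP; rewrite eq_le ge_max lexx /= subr_le0 le_max lexx andbT.
  by rewrite leNgt us.
Unshelve. all: by end_near. Qed.

End BaireSelection.

(** * Baire functions on the line *)

Section BaireLine.
Variable R : realType.
Implicit Types (Z : set R) (g v : R -> R) (d : nat -> R).

Notation baire := (@baire_class R R setT setT).

(** The distance to [Z] truncated at 1; the extra element 1 makes the infimum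
    meaningful for an empty [Z]. *)
Definition gap Z (x : R) : R :=
  inf [set r | r = 1 \/ exists2 z, Z z & r = `|x - z|].

Let gap_lb Z x : lbound [set r | r = 1 \/ exists2 z, Z z & r = `|x - z|] 0.
Proof. by move=> r [->|[z _ ->]]. Qed.

Let gap_n0 Z x : [set r : R | r = 1 \/ exists2 z, Z z & r = `|x - z|] !=set0.
Proof. by exists 1; left. Qed.

Lemma gap_ge0 Z x : 0 <= gap Z x.
Proof. by apply: lb_le_inf; [exact: gap_n0|exact: gap_lb]. Qed.

Lemma gap_lipschitz Z x y : gap Z x <= gap Z y + `|x - y|.
Proof.
rewrite -lerBlDr; apply: lb_le_inf => // r Hr; rewrite lerBlDr.
have lbx : has_lbound [set r | r = 1 \/ exists2 z, Z z & r = `|x - z|].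
  by exists 0; exact: gap_lb.
case: Hr => [->|[z Zz ->]].
  apply: (@le_trans _ _ 1); last by rewrite lerDl.
  by apply: ge_inf => //; left.
apply: (@le_trans _ _ `|x - z|); last by rewrite [leRHS]addrC; exact: ler_distD.
by apply: ge_inf => //; right; exists z.
Qed.

Lemma gap_continuous Z : continuous (gap Z).
Proof.
move=> x; apply/cvgrPdist_lt => e e0; near=> y.
have xy : `|x - y| < e by near: y; apply/nbhs_ballP; exists e.
apply: le_lt_trans xy; have := gap_lipschitz Z x y.
by have := gap_lipschitz Z y x; rewrite distrC ler_norml; lra.
Unshelve. all: by end_near. Qed.

Lemma gap_eq0 Z x : closed Z -> gap Z x = 0 <-> Z x.
Proof.
move=> cZ; split=> [g0|Zx]; last first.
  apply/eqP; rewrite eq_le gap_ge0 andbT; apply: ge_inf.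
    by exists 0; exact: gap_lb.
  by right; exists x => //; rewrite subrr normr0.
apply: cZ => B /nbhs_ballP[e /= e0 eB].
have m0 : 0 < Num.min e 1 by rewrite lt_min e0 ltr01.
have /inf_lt : gap Z x < Num.min e 1 by rewrite g0.
move=> /(_ (@gap_n0 Z x))[r].
move=> -[->|[z Zz ->]]; rewrite lt_min => /andP[xz]; first by rewrite ltxx.
by move=> _; exists z; split => //; exact: eB.
Qed.

Lemma baire_neq (c : R) alpha : ord_le ord_one alpha ->
  baire alpha (fun x => (x != c)%:R).
Proof.
move=> a1; apply: (@baire_class_lim _ _ _ _ _ _ (fun=> ord_zero)
    (fun k x => saturate k `|x - c|)) => //.
- by move=> _; exact/ord_lt_succ_le.
- move=> k; apply: baire_class0; [exact: ord_le_refl|by []|].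
  apply: continuous_subspaceT => x.
  apply: (@continuous_comp _ _ _ (fun x => `|x - c|) (@saturate R k)).
    by apply: cvg_norm; apply: cvgB; [exact: cvg_id|exact: cvg_cst].
  exact: saturate_continuous.
- move=> x _; apply: cvg_near_cst; case: eqVneq => [->|xc] /=.
    by near=> k; rewrite subrr normr0 saturate0.
  apply: (@saturate_near1 _ `|x - c|); first by rewrite normr_gt0 subr_eq0.
  by near=> k.
Unshelve. all: by end_near. Qed.

Fixpoint patch d v g n (x : R) : R :=
  if n is m.+1 then if x == d m then v x else patch d v g m x else g x.

Lemma baire_patch d v g n alpha : ord_le ord_one alpha ->
  baire alpha g -> baire alpha (patch d v g n).
Proof.
move=> a1 bg; elim: n => [//|n IH] /=.
pose p x := (x != d n)%:R * patch d v g n x + (1 - (x != d n)%:R) * v (d n).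
apply: (@baire_class_eq _ _ _ _ _ p).
  move=> x _; rewrite /p; case: eqVneq => [->|_] /=.
    by rewrite mul0r add0r subr0 mul1r.
  by rewrite mul1r subrr mul0r addr0.
apply: baireD; first by apply: baireM => //; exact: baire_neq.
by apply: baireM; [apply: baire_onem; exact: baire_neq|exact: baire_class_cst].
Qed.

Lemma patch_in d v g n i : (i < n)%N -> patch d v g n (d i) = v (d i).
Proof.
elim: n => [//|n IH] /=; rewrite ltnS leq_eqVlt => /predU1P[->|/IH ->].
  by rewrite eqxx.
by case: ifP.
Qed.

Lemma patch_out d v g n x : (forall i, x <> d i) -> patch d v g n x = g x.
Proof.
by move=> xd; elim: n => [//|n IH] /=; case: eqP => [/xd|].
Qed.

Lemma patch_or d v g n x :
  patch d v g n x = v x \/ patch d v g n x = g x.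
Proof. by elim: n => [|n IH] /=; [right|case: ifP => // _; left]. Qed.

End BaireLine.

(** An arbitrary function of finitely many bits is a polynomial in these
    bits. *)
Lemma baire_bits (R : realType) (S : topologicalType) alpha
    (G : nat -> S -> R) (I : seq bool -> R) (s : seq nat) :
  (forall l, baire_class setT setT alpha (G l)) ->
  (forall l x, G l x = 0 \/ G l x = 1) ->
  baire_class setT setT alpha (fun x => I [seq G l x == 1 | l <- s]).
Proof.
move=> bG G01; elim: s I => [|l s IH] I /=; first exact: baire_class_cst.
apply: (@baire_class_eq _ _ _ _ _ (fun x =>
  G l x * I (true :: [seq G l x == 1 | l <- s]) +
  (1 - G l x) * I (false :: [seq G l x == 1 | l <- s]))).
  move=> x _; have [->|->] := G01 l x.
    by rewrite mul0r add0r subr0 mul1r eq_sym oner_eq0.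
  by rewrite mul1r subrr mul0r addr0 eqxx.
apply: baireD; apply: baireM => //.
- exact: (IH (fun s => I (true :: s))).
- exact: baire_onem.
- exact: (IH (fun s => I (false :: s))).
Qed.

(** The function [h \o Q], with [Q] continuous off a sequence [d], agrees off
    [d] with a 0-1 valued function of the same class on the whole line.  Having
    only two values is what makes this possible in class 1, where it becomes a
    question about closed sets, and the higher classes follow by induction. *)
Section BinaryExtension.
Variables (R : realType) (S : topologicalType) (M : set S).
Variables (Q : R -> S) (d : nat -> R).
Hypothesis QM : forall x, M (Q x).
Hypothesis Qcont : forall x, (forall i, x <> d i) -> {for x, continuous Q}.

(** The points off [d] where [h \o Q] is 0, or 1, are a countable union of sets
    [Z0 i] that are closed in the complement of [d].  Their closures in the line
    only add points of [d], so the first label along these closures is right off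
    [d]; the points of [d] themselves are thrown in to cover the line. *)
Lemma binary_extend1 (h : S -> R) :
  baire_class M setT ord_one h -> (forall z, M z -> h z = 0 \/ h z = 1) ->
  exists g : R -> R, [/\ baire_class setT setT ord_one g, forall x, g x = 0 \/ g x = 1 &
    forall x, (forall i, x <> d i) -> g x = h (Q x)].
Proof.
move=> bh h01; have [eta [u [ea bu uh]]] := baire_class_posE (ord_le_refl _) bh.
have cu k : {within M, continuous (u k)}.
  by have /ord_lt_succ := ea k; move/baire_class_continuous; exact.
pose half i r := if odd i then 1 / 2 <= r :> R else r <= 1 / 2.
pose Z0 i := [set x | (forall l, x <> d l) /\
  forall k, (i./2 <= k)%N -> half i (u k (Q x))].
pose Z i := closure (Z0 i) `|` [set d i./2].
have cZ i : closed (Z i).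
  by apply: closedU; [exact: closed_closure|exact: closed_eq].
(* Continuity of [Q] at [x] shows that the closure of [Z0 i] adds no such [x]. *)
have Z0E i x : (forall l, x <> d l) -> Z i x -> Z0 i x.
  move=> xd [clx|/xd//]; split => // k ik.
  have cux : u k (Q y) @[y --> x] --> u k (Q x).
    move/subspace_continuousP : (cu k) => /(_ _ (QM x)).
    apply: cvg_comp => A MA.
    have : nbhs x (fun y => M (Q y) -> A (Q y)) := Qcont xd MA.
    by apply: filterS => y; apply; exact: QM.
  apply: contrapT => nh.
  have /clx[y [[_ /(_ k ik) hy]]] :
      nbhs x [set y | ~ half i (u k (Q y))].
    move: nh; rewrite /half; case: (odd i) => /negP; rewrite -ltNge => lt.
      have : nbhs x [set y | u k (Q y) < 1 / 2] := cux _ (lt_nbhsl lt).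
      by apply: filterS => y /=; rewrite ltNge => /negP.
    have : nbhs x [set y | 1 / 2 < u k (Q y)] := cux _ (lt_nbhsr lt).
    by apply: filterS => y /=; rewrite ltNge => /negP.
  by [].
have [||||g bg gP] := @first_zero_label R R setT ord_one
    (fun i k x => saturate k (gap (Z i) x)) (fun i => (odd i)%:R).
- exact: ord_le_refl.
- move=> i k; exists ord_zero; first exact: ord_one_gt0.
  apply: baire_class0; [exact: ord_le_refl|by []|].
  apply: continuous_subspaceT => x.
  apply: (@continuous_comp _ _ _ (gap (Z i)) (@saturate R k)); first exact: gap_continuous.
  exact: saturate_continuous.
- move=> x _ i; have [g0|gn0] := eqVneq (gap (Z i) x) 0.
    by left=> k; rewrite g0 saturate0.
  right; apply: (@saturate_near1 _ (gap (Z i) x)); first by rewrite lt_def gn0 gap_ge0.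
  by near=> k.
- move=> x _; suff [i Zx] : exists i, Z i x.
    by exists i => k; have /gap_eq0 -> := Zx => //; rewrite saturate0.
  have [[l ->]|nd] := pselect (exists l, x = d l).
    by exists l.*2; right; rewrite doubleK.
  have xd l : x <> d l by move=> xl; apply: nd; exists l.
  have ev (P : R -> Prop) : (\forall r \near h (Q x), P r) ->
      exists N, forall j, (N <= j)%N -> P (u j (Q x)).
    by move=> /(uh _ (QM x))[N _ NP]; exists N => j Nj; exact: NP.
  have [hQ|hQ] := h01 _ (QM x).
    have [|N NP] := ev (fun r => r < 1 / 2); first by apply: lt_nbhsl; rewrite hQ; lra.
    exists N.*2; left; apply: subset_closure; split => // k.
    by rewrite doubleK /half odd_double => /NP /ltW.
  have [|N NP] := ev (fun r => 1 / 2 < r); first by apply: lt_nbhsr; rewrite hQ; lra.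
  exists N.*2.+1; left; apply: subset_closure; split => // k.
  by rewrite /= uphalf_double /half /= odd_double => /NP /ltW.
exists g; split => //.
  by move=> x; have [i _ ->] := gP x I; case: (odd i); [right|left].
move=> x xd; have [i gi ->] := gP x I.
have Zx : Z0 i x.
  apply: Z0E => //; apply/gap_eq0 => //; move: (gi 1%N).
  rewrite /saturate mul1r minEle; case: ifP => // _ /eqP.
  by rewrite oner_eq0.
have lim := uh _ (QM x).
have evZ : \forall k \near \oo, half i (u k (Q x)).
  by near=> k; apply: Zx.2; near: k; exact: nbhs_infty_ge.
move: evZ; rewrite /half; case: (odd i) => evZ.
  have hQ : 1 / 2 <= h (Q x).
    by rewrite -(cvg_lim (@Rhausdorff R) lim); apply: limr_ge => //; exact: cvgP lim.
  by have [hQ0|->//] := h01 _ (QM x); move: hQ; rewrite hQ0 leNgt divr_gt0.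
have hQ : h (Q x) <= 1 / 2.
  by rewrite -(cvg_lim (@Rhausdorff R) lim); apply: limr_le => //; exact: cvgP lim.
by have [->//|hQ1] := h01 _ (QM x); move: hQ; rewrite hQ1; lra.
Unshelve. all: by end_near. Qed.

(** By [baire_separate] a 0-1 valued function of class [alpha > 1] is a limit of
    0-1 valued functions of smaller positive class, to which the induction
    hypothesis applies.  Their extensions need not converge on [d]; patching the
    [k]-th one on the first [k] points of [d] forces the limit there. *)
Lemma binary_extend alpha (h : S -> R) : ord_le ord_one alpha ->
  baire_class M setT alpha h -> (forall z, M z -> h z = 0 \/ h z = 1) ->
  exists g : R -> R, [/\ baire_class setT setT alpha g, forall x, g x = 0 \/ g x = 1 &
    forall x, (forall i, x <> d i) -> g x = h (Q x)].
Proof.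
elim/(well_founded_induction ord_lt_wf): alpha h => alpha IH h a1 bh h01.
have [ale|agt] := ord_le_total alpha ord_one.
  have [g [bg g01 gh]] := binary_extend1 (baire_class_mono ale bh) h01.
  by exists g; split => //; exact: baire_class_mono bg.
have [eta0 [u0 [ea0 bu0 uh0]]] := baire_class_posE a1 bh.
have step k : exists e_g : ordinal_number * (R -> R),
    [/\ ord_lt e_g.1 alpha, ord_le ord_one e_g.1,
        baire_class setT setT e_g.1 e_g.2, forall x, e_g.2 x = 0 \/ e_g.2 x = 1 &
        forall x, (forall i, x <> d i) ->
          (u0 k (Q x) <= 1 / 3 -> e_g.2 x = 0) /\
          (2 / 3 <= u0 k (Q x) -> e_g.2 x = 1)].
  have [e [e_lt le1 le2]] := ord_max_lt agt (ea0 k).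
  have [|v [bv v01 v0 v1]] := @baire_separate _ _ _ _ _ (1 / 3) (2 / 3) le1
    (baire_class_mono le2 (bu0 k)); first lra.
  have [g [bg g01 gh]] := IH e e_lt v le1 bv v01.
  exists (e, g); split => //= x xd; rewrite gh//.
  by split=> ?; [exact: v0|exact: v1].
have [eg egP] := choice step.
pose g x := if `[< exists i, x = d i >] then 0 else h (Q x).
exists g; split.
- apply: (@baire_class_lim _ _ _ _ _ _ (fun k => (eg k).1)
    (fun k => patch d (fun=> 0) (eg k).2 k)) => //.
  + by move=> k; have [] := egP k.
  + by move=> k; have [_ e1 bg _ _] := egP k; exact: baire_patch.
  + move=> x _; apply: cvg_near_cst; rewrite /g.
    have [[i ->]|nd] := pselect (exists i, x = d i).
      rewrite asboolT; last by exists i.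
      by near=> k; rewrite patch_in//; near: k; exact: nbhs_infty_gt.
    have xd i : x <> d i by move=> xi; apply: nd; exists i.
    rewrite asboolF//.
    have [hQ|hQ] := h01 _ (QM x).
      have ev : \forall k \near \oo, u0 k (Q x) < 1 / 3.
        have lt : h (Q x) < 1 / 3 by rewrite hQ; lra.
        exact: (uh0 _ (QM x) _ (lt_nbhsl lt)).
      near=> k; rewrite patch_out// hQ; have [_ _ _ _ /(_ x xd)[+ _]] := egP k; apply.
      by apply: ltW; near: k.
    have ev : \forall k \near \oo, 2 / 3 < u0 k (Q x).
      have lt : 2 / 3 < h (Q x) by rewrite hQ; lra.
      exact: (uh0 _ (QM x) _ (lt_nbhsr lt)).
    near=> k; rewrite patch_out// hQ; have [_ _ _ _ /(_ x xd)[_ +]] := egP k; apply.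
    by apply: ltW; near: k.
- by move=> x; rewrite /g; case: ifP => _; [left|exact: h01].
- by move=> x xd; rewrite /g asboolF// => -[i /xd].
Unshelve. all: by end_near. Qed.

End BinaryExtension.

(** * Disjoint paths in a strip keep their order *)

(** A discrete form of the crossing of two paths in a square, where [U] and [V]
    are signs at the nodes of a grid.  Call an edge a door if [V] changes along
    it while [U] holds at both ends.  If in each cell [U] or [V] is constant,
    then each cell has an even number of doors: none if [V] is constant, and
    otherwise all the sign changes of [V] around the cell or none of them.
    Summing over the cells, the boundary has an even number of doors, whereas
    the boundary conditions leave exactly one, next to the corner [(N, N)]. *)
Lemma grid_sign_cell (N : nat) (U V : nat -> nat -> bool) :
  (0 < N)%N ->
  (forall i, (i <= N)%N -> V i 0%N) -> (forall j, (j <= N)%N -> V N j) ->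
  (forall j, (0 < j <= N)%N -> ~~ V 0%N j) -> (forall i, (i < N)%N -> ~~ V i N) ->
  ~~ U 0%N 0%N -> U N.-1 N -> U N N ->
  ~ (forall i j, (i < N)%N -> (j < N)%N ->
      (forall i' j', (i <= i' <= i.+1)%N -> (j <= j' <= j.+1)%N -> U i' j' = U i j)
   \/ (forall i' j', (i <= i' <= i.+1)%N -> (j <= j' <= j.+1)%N -> V i' j' = V i j)).
Proof.
move=> N0 Vbot Vright Vleft Vtop U00 UN1 UNN cell.
pose door i j i' j' := [&& V i j != V i' j', U i j & U i' j'].
pose hd i j := door i j i.+1 j; pose vd i j := door i j i j.+1.
have cellE i j : (i < N)%N -> (j < N)%N ->
    hd i j (+) hd i j.+1 = vd i j (+) vd i.+1 j.
  move=> iN jN; have [c|c] := cell i j iN jN.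
    have := (c i j, c i.+1 j, c i j.+1, c i.+1 j.+1); rewrite /hd /vd /door.
    rewrite !leqnn !leqnSn => -[[[_ -> //] -> //] -> //].
    by case: (U i j) (V i j) (V i.+1 j) (V i j.+1) (V i.+1 j.+1) => [] [] [] [] [].
  have := (c i j, c i.+1 j, c i j.+1, c i.+1 j.+1); rewrite /hd /vd /door.
  rewrite !leqnn !leqnSn => -[[[_ -> //] -> //] -> //].
  by rewrite eqxx.
pose hs n j := \big[addb/false]_(i < n) hd i j.
have rowE n j : (n <= N)%N -> (j < N)%N ->
    hs n j (+) hs n j.+1 = vd 0%N j (+) vd n j.
  move=> + jN; rewrite /hs -big_split /=; elim: n => [|n IH] nN.
    by rewrite big_ord0 addbb.
  by rewrite big_ord_recr /= IH ?(ltnW nN)// cellE// addbA addbK.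
have hs0 : hs N 0%N = false.
  by rewrite /hs big1// => i _; rewrite /hd /door !Vbot// ltnW.
have vd0 j : (j < N)%N -> vd 0%N j = false.
  move=> jN; rewrite /vd /door; case: j jN => [|j] jN; first by rewrite (negbTE U00) andbF.
  by rewrite (negbTE (Vleft _ _)) ?(negbTE (Vleft _ _))//= ltnW.
have vdN j : (j < N)%N -> vd N j = false.
  by move=> jN; rewrite /vd /door !Vright// ltnW.
have hsN j : (j <= N)%N -> hs N j = false.
  elim: j => [//|j IH] jN.
  by have := rowE N j (leqnn N) jN; rewrite vd0// vdN// IH ?(ltnW jN).
suff : hs N N by rewrite hsN.
have -> : hs N N = hs N.-1.+1 N by rewrite prednK.
rewrite /hs big_ord_recr /= big1 => [|i _].
  rewrite /hd /door prednK// (negbTE (Vtop _ _)) ?prednK//.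
  by rewrite Vright// UN1 UNN.
have iN : (i.+1 < N)%N by move: (ltn_ord i); rewrite ltn_predRL.
by rewrite /hd /door (negbTE (Vtop _ _)) ?(negbTE (Vtop _ iN))//= ltnW.
Qed.

Section Crossing.
Variable R : realType.
Implicit Types (a b : R -> R * R) (q : R * R).

(** A common point of the two paths is a common zero of the differences [u] and
    [v] of their coordinates on the unit square.  Without one, each point of the
    square has a neighbourhood on which [u] or [v] has constant sign; by
    compactness the cells of a fine grid inherit this, against
    [grid_sign_cell]. *)
Lemma paths_cross a b (r : R) : continuous a -> continuous b ->
  (a 0).2 = 0 -> (b 0).2 = 0 -> (a 1).2 = r -> (b 1).2 = r ->
  (forall t : R, 0 < t < 1 -> 0 < (a t).2 < r) ->
  (forall t : R, 0 < t < 1 -> 0 < (b t).2 < r) -> 0 < r ->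
  (a 0).1 < (b 0).1 -> (b 1).1 < (a 1).1 ->
  exists s t : R, [/\ 0 <= s <= 1, 0 <= t <= 1 & a s = b t].
Proof.
move=> ca cb a0 b0 a1 b1 a01 b01 r0 ab0 ba1; apply: contrapT => nab.
pose u q := (a q.1).1 - (b q.2).1; pose v q := (a q.1).2 - (b q.2).2.
have cfst (T T' : topologicalType) : continuous (@fst T T') by move=> q; exact: cvg_fst.
have csnd (T T' : topologicalType) : continuous (@snd T T') by move=> q; exact: cvg_snd.
have cu : continuous u.
  move=> q; apply: cvgB.
    apply: (@continuous_comp _ _ _ (a \o fst) fst); last exact: cfst.
    by apply: continuous_comp; [exact: cfst|exact: ca].
  apply: (@continuous_comp _ _ _ (b \o snd) fst); last exact: cfst.
  by apply: continuous_comp; [exact: csnd|exact: cb].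
have cv : continuous v.
  move=> q; apply: cvgB.
    apply: (@continuous_comp _ _ _ (a \o fst) snd); last exact: csnd.
    by apply: continuous_comp; [exact: cfst|exact: ca].
  apply: (@continuous_comp _ _ _ (b \o snd) snd); last exact: csnd.
  by apply: continuous_comp; [exact: csnd|exact: cb].
pose U q := 0 < u q; pose V q := 0 <= v q.
pose close N q p := `|q.1 - p.1| <= N.+1%:R^-1 :> R /\ `|q.2 - p.2| <= N.+1%:R^-1 :> R.
have locc (w : R * R -> bool) p : (\forall q \near p, w q = w p) ->
    \forall p' \near p & N \near \oo, forall q, close N q p' -> w q = w p'.
  move=> /nbhs_ballP[e /= e0 eP].
  exists (ball p (e / 2), [set N | N.+1%:R^-1 < e / 2]).
    split; first by apply: nbhsx_ballx; rewrite divr_gt0.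
    by apply: near_infty_natSinv_lt (PosNum _); rewrite divr_gt0.
  move=> [p' N] /= [pp' Ne] q [q1 q2]; rewrite (eP q) ?(eP p')//.
    by apply: le_ball pp'; rewrite ler_pdivrMr// ler_peMr ?ltW// ltr1n.
  case: pp' => /= p1 p2; split => /=; rewrite /ball /= in p1 p2 *.
    have := ler_distD p'.1 p.1 q.1; rewrite (distrC p'.1) => /le_lt_trans; apply.
    by rewrite [ltRHS](splitr e) ltrD// (le_lt_trans q1).
  have := ler_distD p'.2 p.2 q.2; rewrite (distrC p'.2) => /le_lt_trans; apply.
  by rewrite [ltRHS](splitr e) ltrD// (le_lt_trans q2).
pose K := `[0, 1]%classic `*` `[0, 1]%classic : set (R * R).
have cK : compact K by apply: compact_setX; exact: segment_compact.
(* The near-covering form of compactness replaces a Lebesgue number. *)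
have [N0 _ N0P] : \forall N \near \oo, K `<=` [set p |
    (forall q, close N q p -> U q = U p) \/ (forall q, close N q p -> V q = V p)].
  move/compact_near_coveringP : cK; apply => p Kp.
  have [u0|un0] := eqVneq (u p) 0.
    have vn0 : v p != 0.
      apply/eqP => v0; apply: nab; exists p.1, p.2.
      move: Kp => [/= /itvP K1 /itvP K2]; rewrite !K1 !K2; split => //.
      move/eqP: u0; move/eqP: v0; rewrite !subr_eq0.
      by case: (a p.1) (b p.2) => ? ? [? ?] /= /eqP -> /eqP ->.
    have /locc : \forall q \near p, V q = V p.
      move: vn0; rewrite /V neq_lt => /orP[vlt|vgt].
        have ev : \forall q \near p, v q < 0 := cv p _ (lt_nbhsl vlt).
      apply: filterS ev => q /= vq.
        by rewrite !leNgt vlt vq.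
      have ev : \forall q \near p, 0 < v q := cv p _ (lt_nbhsr vgt).
      apply: filterS ev => q /= vq.
      by rewrite !ltW.
    by move=> [A AA AB]; exists A => // -[p' N] /AB H; right.
  have /locc : \forall q \near p, U q = U p.
    move: un0; rewrite /U neq_lt => /orP[vlt|vgt].
      have ev : \forall q \near p, u q < 0 := cu p _ (lt_nbhsl vlt).
      apply: filterS ev => q /= vq.
      by rewrite !ltNge !ltW.
    have ev : \forall q \near p, 0 < u q := cu p _ (lt_nbhsr vgt).
      apply: filterS ev => q /= vq.
    by rewrite vgt vq.
  by move=> [A AA AB]; exists A => // -[p' N] /AB H; left.
have U11 : 0 < u (1, 1) by rewrite /u /= subr_gt0.
have /nbhs_ballP[e /= e0 eP] : \forall q \near ((1, 1) : R * R), 0 < u q :=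
  cu _ _ (lt_nbhsr U11).
have [N1 _ N1P] := near_infty_natSinv_lt (PosNum e0).
pose N := maxn N0 N1; pose g i : R := i%:R / N.+1%:R.
have N10 : 0 < N.+1%:R :> R by rewrite ltr0n.
have g0 : g 0%N = 0 by rewrite /g mul0r.
have g1 : g N.+1 = 1 by rewrite /g divff// lt0r_neq0.
have gI i : (i <= N.+1)%N -> 0 <= g i <= 1.
  by move=> iN; rewrite /g divr_ge0//= ler_pdivrMr// mul1r ler_nat.
have gpos i : (0 < i)%N -> 0 < g i by move=> i0; rewrite divr_gt0// ltr0n.
have glt i : (i <= N)%N -> g i < 1 by move=> i0; rewrite ltr_pdivrMr// mul1r ltr_nat.
have gS i i' : (i <= i' <= i.+1)%N -> `|g i' - g i| <= N.+1%:R^-1.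
  move=> /andP[ii' i'i]; rewrite -mulrBl -natrB// ger0_norm ?divr_ge0//.
  by rewrite ler_piMl ?invr_ge0// lern1 leq_subLR addn1.
have h_ge0 (c : R -> R * R) t : (c 0).2 = 0 -> (c 1).2 = r ->
    (forall t : R, 0 < t < 1 -> 0 < (c t).2 < r) -> 0 <= t <= 1 -> 0 <= (c t).2 <= r.
  move=> c0 c1 c01 /andP[]; rewrite le_eqVlt => /predU1P[<- _|t0].
    by rewrite c0 lexx ltW.
  rewrite le_eqVlt => /predU1P[->|t1]; first by rewrite c1 lexx ltW.
  by have /andP[? ?] := c01 t (introT andP (conj t0 t1)); rewrite !ltW.
apply: (@grid_sign_cell N.+1 (fun i j => U (g i, g j)) (fun i j => V (g i, g j))) => //.
- move=> i iN; rewrite /V /v /= g0 b0 subr0.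
  by have /andP[] := h_ge0 a _ a0 a1 a01 (gI _ iN).
- move=> i iN; rewrite /V /v /= g1 a1 subr_ge0.
  by have /andP[] := h_ge0 b _ b0 b1 b01 (gI _ iN).
- move=> j /andP[j0 jN]; rewrite /V /v /= g0 a0 sub0r oppr_ge0 -ltNge.
  move: jN; rewrite leq_eqVlt => /predU1P[->|jN]; first by rewrite g1 b1.
  by have /andP[] := b01 (g j) (introT andP (conj (gpos _ j0) (glt _ jN))).
- move=> i iN; rewrite /V /v /= g1 b1 subr_ge0 -ltNge.
  case: i iN => [|i] iN; first by rewrite g0 a0.
  by have /andP[] := a01 (g i.+1) (introT andP (conj (gpos i.+1 isT) (glt i.+1 iN))).
- by rewrite /U /u /= g0 subr_gt0 -leNgt ltW.
- rewrite /U /= g1; apply: eP; split => /=; last exact: ballxx.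
  rewrite /ball /= -g1; apply: le_lt_trans (gS _ _ _) _; first by rewrite leqnSn leqnn.
  by apply: N1P; exact: leq_maxr.
- by rewrite /U g1.
- move=> i j iN jN.
  have Kij : K (g i, g j).
    by split; rewrite /= in_itv /=; apply: gI; exact: ltnW.
  have [H|H] := N0P N (leq_maxl _ _) _ Kij; [left|right] => i' j' ii' jj';
    by rewrite H//; split => /=; exact: gS.
Qed.

(** The part of an arc up to its first arrival at height [r].  Simplicity of the
    arc is dropped because only the mutual disjointness of stems matters. *)
Definition stem (A : set (R * R)) (r x p : R) := exists c : R -> R * R,
  [/\ continuous c, c 0 = (x, 0), c 1 = (p, r),
      forall t : R, 0 < t < 1 -> 0 < (c t).2 < r & forall t : R, 0 < t <= 1 -> A (c t)].

Lemma stem_tip (A : set (R * R)) (r x p : R) : stem A r x p -> A (p, r).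
Proof. by move=> [c [_ _ <- _]]; apply; rewrite ltr01 lexx. Qed.

(** Otherwise the two paths would cross, either at their tips or by
    [paths_cross]; a common point has positive height because the feet differ,
    so it is in both [A] and [B]. *)
Lemma stem_order (A B : set (R * R)) (r x y p q : R) : 0 < r -> A `&` B `<=` set0 ->
  stem A r x p -> stem B r y q -> x < y -> p < q.
Proof.
move=> r0 AB sA sB xy; rewrite ltNge; apply/negP; rewrite le_eqVlt => /predU1P[qp|qp].
  by apply: (AB (p, r)); split; [exact: stem_tip sA|rewrite -qp; exact: stem_tip sB].
case: sA => a [ca a0 a1 a01 aA]; case: sB => b [cb b0 b1 b01 bB].
have [s [t [/andP[+ +] /andP[+ +]]]] : exists s t : R,
    [/\ 0 <= s <= 1, 0 <= t <= 1 & a s = b t].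
  by apply: (paths_cross ca cb _ _ _ _ a01 b01 r0); rewrite ?a0 ?a1 ?b0 ?b1.
have up (c : R -> R * R) (z w u : R) : c 0 = (z, 0) -> c 1 = (w, r) ->
    (forall t : R, 0 < t < 1 -> 0 < (c t).2 < r) -> 0 < u -> u <= 1 -> 0 < (c u).2.
  move=> c0 c1 c01 u0; rewrite le_eqVlt => /predU1P[->|u1]; first by rewrite c1.
  by have := c01 u; rewrite u0 u1 => /(_ isT)/andP[].
rewrite le_eqVlt => /predU1P[<-|s0] s1;
    rewrite le_eqVlt => /predU1P[<-|t0] t1.
- by rewrite a0 b0 => -[xy']; move: xy; rewrite xy' ltxx.
- by rewrite a0 => abt; have := up b _ _ _ b0 b1 b01 t0 t1; rewrite -abt ltxx.
- by rewrite b0 => abt; have := up a _ _ _ a0 a1 a01 s0 s1; rewrite abt ltxx.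
- move=> abt; apply: (AB (a s)); split; first by apply: aA; rewrite s0.
  by rewrite abt; apply: bB; rewrite t0.
Qed.

End Crossing.

(** * Arcs at boundary points *)

Section Levels.
Variable R : realType.
Implicit Types (A B : set R) (S T : set (R * R)).

Definition clamp (t : R) : R := Num.max 0 (Num.min 1 t).

Lemma clamp_continuous : continuous clamp.
Proof.
move=> t; rewrite -[clamp]/((fun=> 0) \max ((fun=> 1) \min id)).
apply: continuous_max; first exact: cst_continuous.
by apply: continuous_min; [exact: cst_continuous|exact: cvg_id].
Qed.

Lemma clamp_itv t : 0 <= clamp t <= 1.
Proof. by rewrite /clamp le_max lexx /= ge_max ler01 ge_min lexx. Qed.

Lemma clamp_id t : 0 <= t <= 1 -> clamp t = t.
Proof. by move=> /andP[t0 t1]; rewrite /clamp min_r// max_r. Qed.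

Lemma continuous_clamp (U : topologicalType) (c : R -> U) :
  {within `[0, 1], continuous c} -> continuous (c \o clamp).
Proof.
move=> /subspace_continuousP cc t.
have It : `[0, 1]%classic (clamp t) by rewrite /= in_itv /= clamp_itv.
move=> A cA; have cA' := cc _ It _ cA.
have : nbhs t (fun s => `[0, 1]%classic (clamp s) -> A (c (clamp s))) :=
  clamp_continuous cA'.
by apply: filterS => s; apply; rewrite /= in_itv /= clamp_itv.
Qed.

Lemma first_hit (y : R -> R) (b r : R) : continuous y -> 0 <= b ->
  y 0 < r -> r <= y b ->
  exists2 t, 0 < t <= b & y t = r /\ forall s, 0 <= s < t -> y s < r.
Proof.
move=> cy b0 y0 yb.
pose K := `[0, b]%classic `&` [set t | r <= y t].
have cK : compact K.
  apply: (subclosed_compact _ (@segment_compact R 0 b)); last by move=> t [].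
  apply: closedI; first exact: itv_closed.
  by move/continuous_closedP : cy => /(_ _ (@closed_ge _ r)).
have K0 : K !=set0 by exists b; split => //=; rewrite in_itv /= b0 lexx.
have [t] := @compact_EVT_min R R id K K0 cK (continuous_subspaceT (fun=> cvg_id)).
rewrite inE => -[]; rewrite /= in_itv /= => /andP[t0 tb] yt tmin.
have lt_r s : 0 <= s < t -> y s < r.
  move=> /andP[s0 st]; rewrite ltNge; apply/negP => rs.
  have /= := tmin s; rewrite inE leNgt st => /(_ _)/negP; apply => //.
  by split => //=; rewrite in_itv /= s0 (le_trans (ltW st)).
have {t0}t0 : 0 < t.
  by rewrite lt_def t0 andbT; apply: contraTneq yt => ->; rewrite -ltNge.
exists t; first by rewrite t0.
split => //; apply/eqP; rewrite eq_le yt andbT leNgt; apply/negP => ry.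
have ev : \forall s \near t, r < y s := cy t _ (lt_nbhsr ry).
have /nbhs_ballP[e /= e0 eP] := ev.
have m0 : 0 < Num.min t e by rewrite lt_min t0.
have mt : Num.min t e <= t by rewrite ge_min lexx.
have me : Num.min t e <= e by rewrite ge_min lexx orbT.
pose s := t - Num.min t e / 2.
have : r < y s by apply: eP; rewrite /ball /= /s opprD opprK addNKr ger0_norm; lra.
by apply/negP; rewrite -leNgt ltW// lt_r//; rewrite /s; apply/andP; split; lra.
Qed.

(** Near [x] the arc stays in [S]; for small heights [r], cut this initial part
    of the arc where it first reaches the height [r].  The bound on the tip
    holds since the tip is within 1 of [x]. *)
Lemma arc_stem (x : R) (D : set (R * R)) S : arc_at (x, 0) D ->
  (\forall z \near within (D `\ (x, 0)) (nbhs (x, 0)), S z) ->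
  \forall n \near \oo, exists2 p : R, `|p| <= n%:R & stem S n.+1%:R^-1 x p.
Proof.
move=> [[q [c [cc ci cD c0 c1]]] DH] Snear.
pose c' := c \o clamp.
have cc' : continuous c' by exact: continuous_clamp.
have c'0 : c' 0 = (x, 0) by rewrite /c' /= clamp_id// lexx ler01.
have near0 : \forall t \near 0, ((D `\ (x, 0)) (c' t) -> S (c' t)) /\ `|x - (c' t).1| < 1.
  apply: filterI.
    have : nbhs (c' 0) (fun z => (D `\ (x, 0)) z -> S z) by rewrite c'0.
    exact: cc'.
  have cf : (c' t).1 @[t --> 0] --> x.
    rewrite -[X in _ --> X]/((x, 0 : R).1) -c'0.
    by apply: (@continuous_comp _ _ _ c' fst); [exact: cc'|exact: cvg_fst].
  by move/cvgrPdist_lt : cf; apply; exact: ltr01.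
have [e /= e0 eP] := (nbhs_ballP _ _).1 near0.
pose t0 := Num.min (e / 2) 1.
have t00 : 0 < t0 by rewrite lt_min ltr01 andbT divr_gt0.
have t01 : t0 <= 1 by rewrite ge_min lexx orbT.
have t0e : t0 < e.
  by rewrite /t0 gt_min ltr_pdivrMr// ltr_pMr// ltr1n.
have D't t : 0 < t <= t0 -> (D `\ (x, 0)) (c' t).
  move=> /andP[tp tt]; have tI : 0 <= t <= 1 by rewrite ltW//= (le_trans tt).
  rewrite /c' /= clamp_id//; split.
    by rewrite -cD; exists t => //=; rewrite in_itv.
  rewrite -c0 => /ci; rewrite !inE /= !in_itv /= lexx ler01 tI => /(_ isT isT) t0'.
  by move: tp; rewrite t0' ltxx.
have tP t : 0 <= t <= t0 -> ((D `\ (x, 0)) (c' t) -> S (c' t)) /\ `|x - (c' t).1| < 1.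
  move=> /andP[tp tt]; apply: eP; rewrite /ball /= sub0r normrN ger0_norm//.
  exact: le_lt_trans t0e.
have y0 : 0 < (c' t0).2 by apply: DH; apply: D't; rewrite t00 lexx.
have ev1 := near_infty_natSinv_lt (PosNum y0).
near=> n.
have ry : n.+1%:R^-1 < (c' t0).2 by near: n; exact: ev1.
have xn : `|x| + 1 <= n%:R by near: n; exact: nbhs_infty_ger.
have r0 : 0 < n.+1%:R^-1 :> R by rewrite invr_gt0.
have [||||t /andP[tp tt] [yt ylt]] := @first_hit (snd \o c') t0 n.+1%:R^-1.
- by move=> t; apply: continuous_comp; [exact: cc'|exact: cvg_snd].
- exact: ltW.
- by rewrite /= c'0.
- exact: ltW.
exists (c' t).1.
  have [_] := tP t (introT andP (conj (ltW tp) tt)).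
  have := ler_normB x (x - (c' t).1); rewrite opprB addrC subrK; lra.
have sc u : 0 < u <= 1 -> 0 < t * u <= t0.
  by move=> /andP[u0 u1]; rewrite mulr_gt0//= (le_trans _ tt)// ler_piMr// ltW.
exists (fun u => c' (t * u)); split.
- move=> u; apply: (@continuous_comp _ _ _ ( *%R t) c'); last exact: cc'.
  exact: mulrl_continuous.
- by rewrite mulr0.
- by rewrite mulr1 -yt /=; apply: surjective_pairing.
- move=> u /andP[u0 u1]; have su : 0 < t * u <= t0 by apply: sc; rewrite u0 ltW.
  apply/andP; split; first by apply: DH; apply: D't.
  by apply: ylt; rewrite ltW ?mulr_gt0//= gtr_pMr.
- move=> u /sc su; have su' : 0 <= t * u <= t0.
    by case/andP: su => s0 ->; rewrite ltW.
  by have [+ _] := tP _ su'; apply; exact: D't.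
Unshelve. all: by end_near. Qed.

(** At a discontinuity a pair of rationals fits strictly inside the jump, and
    jumps at different points cannot contain the same pair. *)
Lemma monotone_discontinuities (q : R -> R) : {homo q : x y / x <= y} ->
  exists d : nat -> R, forall x, (forall i, x <> d i) -> {for x, continuous q}.
Proof.
move=> ndq.
pose jump (uv : rat * rat) x := [/\ uv.1 < uv.2, forall y, y < x -> q y <= ratr uv.1 &
  forall y, x < y -> ratr uv.2 <= q y].
have jump_inj uv x y : jump uv x -> jump uv y -> x = y.
  move=> jx jy; apply/eqP; rewrite eq_le.
  wlog suff : x y jx jy / x <= y by move=> H; rewrite !H.
  rewrite leNgt; apply/negP => yx; have [uv12 lx _] := jx; have [_ _ uy] := jy.
  have mx : (y + x) / 2 < x by lra.
  have my : y < (y + x) / 2 by lra.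
  have := le_trans (uy _ my) (lx _ mx).
  by rewrite ler_rat leNgt uv12.
pose d n := xget 0 [set x | exists2 uv, unpickle n = Some uv & jump uv x].
exists d => x xd; apply: contrapT => ncont.
have x1 : x - 1 < x by lra.
have x2 : x < x + 1 by lra.
pose L := q @` [set y | y < x]; pose U := q @` [set y | x < y].
have Lx : ubound L (q x) by move=> _ [y yx <-]; apply: ndq; exact: ltW.
have Ux : lbound U (q x) by move=> _ [y yx <-]; apply: ndq; exact: ltW.
have L0 : L !=set0 by exists (q (x - 1)), (x - 1).
have U0 : U !=set0 by exists (q (x + 1)), (x + 1).
have [LU|UL] := ltP (sup L) (inf U).
  pose s := (sup L + inf U) / 2.
  have /rat_in_itvoo[u] : sup L < s by rewrite /s; lra.
  rewrite in_itv /= => /andP[Lu us].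
  have /rat_in_itvoo[v] : s < inf U by rewrite /s; lra.
  rewrite in_itv /= => /andP[sv vU].
  apply: (xd (pickle (u, v))).
  have jx : jump (u, v) x.
    split => /=; first by rewrite -(ltr_rat R); exact: lt_trans us sv.
      move=> y yx; apply: ltW; apply: le_lt_trans Lu.
      by apply: ub_le_sup; [exists (q x)|exists y].
    move=> y yx; apply: ltW; apply: (lt_le_trans vU).
    by apply: ge_inf; [exists (q x)|exists y].
  rewrite /d; case: xgetP => [z _ [uv']|/(_ x)[]].
    by rewrite pickleK => -[<-] jz; exact: jump_inj jx jz.
  by exists (u, v) => //; rewrite pickleK.
apply: ncont; apply/cvgrPdist_lt => e e0.
have supL : sup L <= q x by apply: ge_sup.
have infU : q x <= inf U by exact: lb_le_inf.
have [_ [y1 /= y1x <-] qy1] : exists2 z, L z & sup L - e < z.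
  by apply: sup_adherent => //; split => //; exists (q x).
have [_ [y2 /= y2x <-] qy2] : exists2 z, U z & z < inf U + e.
  by apply: inf_adherent => //; split => //; exists (q x).
near=> z.
have z1 : y1 <= z by apply: ltW; near: z; exact: lt_nbhsr.
have z2 : z <= y2 by apply: ltW; near: z; exact: lt_nbhsl.
have := ndq _ _ z1; have := ndq _ _ z2.
by rewrite ltr_norml; lra.
Unshelve. all: by end_near. Qed.
End Levels.

(** * Transfer to the boundary *)

Section Selection.
Variable R : realType.

(** [P c x p] says that [p] is available at the point [x] of colour [c], and
    points of different colours are in the order of their values.  Two points of
    the same colour are equivalent if no point of the other colour separates
    them.  All values available in one class lie on the same side of those
    available in another class, so choosing one value for each class gives a
    nondecreasing function on the coloured points, which a supremum extends to
    the line. *)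
Lemma monotone_selection (K : R) (P : bool -> R -> R -> Prop) :
  (forall c x p, P c x p -> `|p| <= K) ->
  (forall c x y p q, P c x p -> P (~~ c) y q -> x < y -> p < q) ->
  (forall c x p q, P c x p -> ~ P (~~ c) x q) ->
  exists q : R -> R, {homo q : x y / x <= y} /\
    forall c x p, P c x p -> exists x', P c x' (q x).
Proof.
move=> PK Plt Pdisj.
pose dom c x := exists p, P c x p.
have dom_neq c x y : dom c x -> dom (~~ c) y -> x <> y.
  by move=> [p xp] [q yq] xy; apply: (Pdisj _ _ _ _ xp); rewrite xy; exact: yq.
pose sep c x x' := exists2 y, dom (~~ c) y & x < y < x' \/ x' < y < x.
pose V c x := [set p | exists2 x', ~ sep c x x' & P c x' p].
pose sel c x := xget 0 (V c x).
have selV c x : dom c x -> V c x (sel c x).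
  move=> [p xp]; apply: xgetPex; exists p, x => // -[y _].
  by move=> [] /andP[xy yx]; have := lt_trans xy yx; rewrite ltxx.
have V_sep c x y p q : dom c x -> dom c y -> x < y -> sep c x y ->
    V c x p -> V c y q -> p < q.
  move=> dx dy xy [z dz zxy] [x' nx' Px'] [y' ny' Py'].
  have {}zxy : x < z < y.
    case: zxy => // /andP[yz zx]; have := lt_trans (lt_trans xy yz) zx.
    by rewrite ltxx.
  move: zxy => /andP[xz zy]; have [r zr] := dz.
  have x'z : x' < z.
    have [//|zx'|x'z] := ltgtP x' z.
      by case: nx'; exists z => //; left; rewrite xz.
    by have := dom_neq c x' z (ex_intro _ _ Px') dz x'z.
  have zy' : z < y'.
    have [//|y'z|zy'] := ltgtP z y'.
      by case: ny'; exists z => //; right; rewrite y'z.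
    by have := dom_neq c y' z (ex_intro _ _ Py') dz (esym zy').
  apply: lt_trans (Plt _ _ _ _ _ Px' zr x'z) _.
  by apply: (Plt (~~ c) z y') => //; rewrite negbK.
have V_eq c x y : dom c x -> dom c y -> x < y -> ~ sep c x y -> V c x = V c y.
  move=> dx dy xy nxy; apply/seteqP; split=> p [x' nx' Px']; exists x' => // -[z dz].
    have xz := dom_neq c x z dx dz; have yz := dom_neq c y z dy dz.
    move=> [] /andP[z1 z2].
      by apply: nx'; exists z => //; left; rewrite (lt_trans xy z1).
    have [xz'|zx|/xz//] := ltgtP x z; last by apply: nx'; exists z => //; right; rewrite z1.
    by apply: nxy; exists z => //; left; rewrite xz'.
  have xz := dom_neq c x z dx dz; have yz := dom_neq c y z dy dz.
  move=> [] /andP[z1 z2].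
    have [yz'|zy|/yz//] := ltgtP y z; first by apply: nx'; exists z => //; left; rewrite yz'.
    by apply: nxy; exists z => //; left; rewrite z1.
  by apply: nx'; exists z => //; right; rewrite z1 (lt_trans z2).
have V_other c x y p q : dom c x -> dom (~~ c) y -> x < y ->
    V c x p -> V (~~ c) y q -> p < q.
  move=> dx dy xy [x' nx' Px'] [y' ny' Py'].
  have x'y : x' < y.
    have [//|yx'|] := ltgtP x' y; first by case: nx'; exists y => //; left; rewrite xy.
    by move/(dom_neq c x' y (ex_intro _ _ Px') dy).
  have x'y' : x' < y'.
    have [//|y'x'|] := ltgtP x' y'.
      case: ny'; exists x'; last by right; rewrite y'x'.
      by rewrite negbK; exists p.
    by move/(dom_neq c x' y' (ex_intro _ _ Px') (ex_intro _ _ Py')).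
  exact: Plt Px' Py' x'y'.
have sel_mono c c' x y : dom c x -> dom c' y -> x < y -> sel c x <= sel c' y.
  move=> dx; have [->|] := eqVneq c' c => [dy xy|].
    have [sxy|nsxy] := pselect (sep c x y).
      by apply: ltW; apply: (V_sep c x y) => //; exact: selV.
    by rewrite /sel (V_eq c x y).
  move=> c'c; have -> : c' = ~~ c by move: c'c; clear; case: c c' => [] [].
  by move=> dy xy; apply: ltW; apply: (V_other c x y) => //; exact: selV.
have selK c x : dom c x -> `|sel c x| <= K.
  by move=> /selV[x' _ /PK].
(* The extra element [- K] keeps the supremum meaningful, and monotone in [x], to
   the left of all coloured points. *)
pose A x := [set p | p = - K \/ exists c y, [/\ dom c y, y <= x & p = sel c y]].
have A0 x : A x !=set0 by exists (- K); left.
have Aub x : ubound (A x) `|K|.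
  move=> p [->|[c [y [dy _ ->]]]]; first by rewrite -normrN ler_norm.
  by rewrite (le_trans (ler_norm _))// (le_trans (selK _ _ dy))// ler_norm.
exists (fun x => sup (A x)); split.
  move=> x y xy; apply: ge_sup => // p [->|[c [z [dz zx ->]]]].
    by apply: ub_le_sup; [exists (`|K|)|left].
  by apply: ub_le_sup; [exists (`|K|)|right; exists c, z; rewrite (le_trans zx)].
move=> c x p xp; have dx : dom c x by exists p.
suff -> : sup (A x) = sel c x by have [x' _ ?] := selV c x dx; exists x'.
apply/eqP; rewrite eq_le; apply/andP; split; last first.
  by apply: ub_le_sup; [exists (`|K|) | right; exists c, x].
apply: ge_sup => // _ [->|[c' [y [dy yx ->]]]].
  by have := selK _ _ dx; rewrite ler_norml => /andP[].
move: yx; rewrite [y <= x]le_eqVlt => /predU1P[yx|]; last exact: sel_mono.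
have [->|] := eqVneq c' c; first by rewrite yx.
move=> neq; have c'c : c' = ~~ c by move: neq; clear; case: c c' => [] [].
rewrite c'c in dy.
by have := dom_neq c x y dx dy (esym yx).
Qed.

Lemma level_map (C : bool -> set R) (S : bool -> set (R * R)) (r K : R) :
  0 < r -> C true `&` C false `<=` set0 -> S true `&` S false `<=` set0 ->
  exists (q : R -> R) (d : nat -> R),
    (forall x, (forall i, x <> d i) -> {for x, continuous q}) /\
    forall c x, C c x -> (exists2 p, `|p| <= K & stem (S c) r x p) -> S c (q x, r).
Proof.
move=> r0 Cdisj Sdisj.
have C0 c x : C c x -> ~ C (~~ c) x.
  by move=> Cx Cx'; apply: (Cdisj x); case: c Cx Cx'.
have S0 c : S c `&` S (~~ c) `<=` set0.
  by case: c => // z [z1 z2]; apply: (Sdisj z).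
have [|||q [qm qP]] := @monotone_selection K
    (fun c x p => [/\ C c x, `|p| <= K & stem (S c) r x p]).
- by move=> c x p [].
- by move=> c x y p q [_ _ s1] [_ _ s2]; exact: stem_order (S0 c) s1 s2.
- by move=> c x p q [Cx _ _] [Cx' _ _]; exact: C0 Cx Cx'.
have [d dP] := monotone_discontinuities qm.
exists q, d; split => // c x Cx [p pK sx].
by have [x' [_ _ /stem_tip]] := qP c x p (And3 Cx pK sx).
Qed.

(** The colour of a point is the value that a separating [h] takes on its arc
    close to the boundary; it is read at the heights [1 / (n + 1)]. *)
Lemma boundary_separate alpha (F phi : R * R -> R) (E : set (R * R)) (a b : R) :
  ord_le ord_one alpha ->
  baire_class (@upper_half_plane R) setT alpha F ->
  E `<=` @x_axis R -> boundary_function F E phi -> a < b ->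
  exists g : nat -> R * R -> R,
    [/\ forall n, baire_class setT setT alpha (g n),
        forall n z, g n z = 0 \/ g n z = 1,
        forall z, E z -> phi z < a -> \forall n \near \oo, g n z = 0 &
        forall z, E z -> b < phi z -> \forall n \near \oo, g n z = 1].
Proof.
move=> a1 bF EX Fphi ab.
have [h [bh h01 h0 h1]] := baire_separate a1 bF ab.
pose S (c : bool) : set (R * R) := [set z | 0 < z.2 /\ h z = c%:R].
pose C c : set R := [set x | E (x, 0) /\ if c then b < phi (x, 0) else phi (x, 0) < a].
have Sdisj : S true `&` S false `<=` set0.
  by move=> z [[_ /= hz1] [_ /=]]; rewrite hz1 => /eqP; rewrite oner_eq0.
have Cdisj : C true `&` C false `<=` set0.
  move=> x [[_ /= bp] [_ pa]]; have := lt_trans (lt_trans bp pa) ab.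
  by rewrite ltxx.
have lev n : exists qd : (R -> R) * (nat -> R),
    (forall x, (forall i, x <> qd.2 i) -> {for x, continuous qd.1}) /\
    forall c x, C c x ->
      (exists2 p : R, `|p| <= n%:R & stem (S c) n.+1%:R^-1 x p) ->
      S c (qd.1 x, n.+1%:R^-1).
  have r0 : 0 < n.+1%:R^-1 :> R by rewrite invr_gt0.
  by have [q [d qdP]] := @level_map C S _ n%:R r0 Cdisj Sdisj; exists (q, d).
have [qd qdP] := choice lev.
pose Q n x : R * R := ((qd n).1 x, n.+1%:R^-1).
have QM n x : (@upper_half_plane R) (Q n x) by rewrite /upper_half_plane /= invr_gt0.
have Qc n x : (forall i, x <> (qd n).2 i) -> {for x, continuous (Q n)}.
  move=> xd; change (((qd n).1 y, n.+1%:R^-1 : R) @[y --> x] --> ((qd n).1 x, n.+1%:R^-1 : R)).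
  exact: (cvg_pair ((qdP n).1 x xd) (cvg_cst (n.+1%:R^-1 : R))).
have ext n := binary_extend (QM n) (Qc n) a1 bh h01.
have [g0 g0P] := choice ext.
(* An enumeration of the exceptional points of all heights; the [n]-th function is
   corrected on its first [n] terms. *)
pose D m := if unpickle m is Some (n, i) then (qd n).2 i else 0.
pose v (x : R) : R := if b < phi (x, 0) then 1 else 0.
pose g n := patch D v (g0 n) n.
have bg n : baire_class setT setT alpha (g n).
  by apply: baire_patch => //; have [] := g0P n.
have limg c x : C c x -> \forall n \near \oo, g n x = c%:R.
  move=> Cx; have [[i xi]|nD] := pselect (exists i, x = D i).
    near=> n; rewrite /g xi patch_in -?xi; last by near: n; exact: nbhs_infty_gt.
    case: c Cx => -[_]; rewrite /v; first by move=> ->.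
    by move=> pa; rewrite ltNge ltW// (lt_trans pa).
  have xD i : x <> D i by move=> xi; apply: nD; exists i.
  have xd n i : x <> (qd n).2 i.
    by have := xD (pickle (n, i)); rewrite /D pickleK.
  have [Ex pc] := Cx; have [A xA Alim] := Fphi _ Ex.
  have FP (P : R -> Prop) : (\forall y \near phi (x, 0), P y) ->
      \forall z \near within (A `\ (x, 0)) (nbhs (x, 0)), P (F z) := fun H => Alim _ H.
  have AH z : (A `\ (x, 0)) z -> (@upper_half_plane R) z by exact: xA.2.
  have Snear : \forall z \near within (A `\ (x, 0)) (nbhs (x, 0)), S c z.
    have wA : \forall z \near within (A `\ (x, 0)) (nbhs (x, 0)), (A `\ (x, 0)) z.
      exact: withinT.
    case: c pc {Cx} => pc.
      apply: filterS2 wA (FP _ (lt_nbhsr pc)) => z /AH Hz /ltW bF'.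
      by split => //; exact: h1.
    apply: filterS2 wA (FP _ (lt_nbhsl pc)) => z /AH Hz /ltW bF'.
    by split => //; exact: h0.
  have st := arc_stem xA Snear.
  near=> n; rewrite /g patch_out//; have [_ _ ->//] := g0P n.
  by have [_] : S c (Q n x); [apply: (qdP n).2 => //; near: n|].
exists (fun n z => g n z.1); split.
- move=> n; apply: (@baire_class_precomp _ _ _ setT setT setT fst) => //.
  by move=> z; exact: cvg_fst.
- move=> n z; rewrite /g; have [->|->] := patch_or D v (g0 n) n z.1.
    by rewrite /v; case: ifP => _; [right|left].
  by have [_ + _] := g0P n; exact.
- move=> [x y] Exy; have /= y0 := EX _ Exy; rewrite /x_axis /= in y0.
  by rewrite y0 in Exy * => pa; exact: (limg false).
- move=> [x y] Exy; have /= y0 := EX _ Exy; rewrite /x_axis /= in y0.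
  by rewrite y0 in Exy * => pb; exact: (limg true).
Unshelve. all: by end_near. Qed.
End Selection.

(** * Approximation in an arcwise connected set *)

Section Approximation.
Variables (R : realType) (V : normedModType R) (Y : set V).

Lemma separable_dense_seq : separable_set Y -> Y !=set0 ->
  exists y : nat -> V, (forall i, Y (y i)) /\
    forall v e, Y v -> 0 < e -> exists i, `|v - y i| < e.
Proof.
move=> [D [cD DY YD]] [v0 Yv0].
have D0 : D <> set0.
  by move=> D0; move: YD; rewrite D0 closure0 => /(_ _ Yv0).
have [//|/surjfunPex[y yE]] := pfcard_geP cD.
exists y; split=> [i|v e Yv e0]; first by apply: DY; rewrite yE; exists i.
have [w [+ vw]] := YD v Yv _ (nbhsx_ballx v _ e0).
by rewrite yE => -[i _ iw]; exists i; rewrite iw; move: vw; rewrite -ball_normE.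
Qed.

Lemma arcwise_path p q : arcwise_connected R Y -> Y p -> Y q ->
  exists c : R -> V, [/\ continuous c, forall t, Y (c t),
    forall t, t <= 0 -> c t = p & forall t, 1 <= t -> c t = q].
Proof.
move=> acY Yp Yq; have [<-|/eqP pq] := eqVneq p q.
  by exists (fun=> p); split => // t; exact: cvg_cst.
have [A [c [cc _ cA c0 c1]] AY] := acY p q Yp Yq pq.
exists (c \o @clamp R); split.
- exact: continuous_clamp.
- by move=> t; apply: AY; rewrite -cA; exists (clamp t) => //=; rewrite in_itv /= clamp_itv.
- by move=> t t0; rewrite /= /clamp (min_r (le_trans t0 ler01)) max_l.
- by move=> t t1; rewrite /= /clamp min_l// max_r.
Qed.

(** Two paths are concatenated at time [n] by adding them and subtracting their
    common point [y n], as each of them rests there while the other moves. *)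
Lemma path_through (y : nat -> V) (n : nat) : arcwise_connected R Y ->
  (forall i, Y (y i)) ->
  exists c : R -> V, [/\ continuous c, forall t, Y (c t) &
    forall i, (i <= n)%N -> c i%:R = y i].
Proof.
move=> acY Yy; elim: n => [|n [c [cc cY cy]]].
  exists (fun=> y 0%N); split => // [t|i]; first exact: cvg_cst.
  by rewrite leqn0 => /eqP ->.
have [g [cg gY g0 g1]] := arcwise_path acY (Yy n) (Yy n.+1).
have ccmin : continuous (c \o (id \min (fun=> n%:R))).
  move=> t; apply: continuous_comp; last exact: cc.
  by apply: continuous_min; [exact: cvg_id|exact: cvg_cst].
have cgB : continuous (g \o (fun t => t - n%:R)).
  move=> t; apply: continuous_comp; last exact: cg.
  by apply: cvgB; [exact: cvg_id|exact: cvg_cst].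
have cL t : t <= n%:R -> c (Num.min t n%:R) + g (t - n%:R) - y n = c t.
  by move=> tn; rewrite min_l// g0 ?subr_le0//; apply: addrK.
have cR t : n%:R <= t -> c (Num.min t n%:R) + g (t - n%:R) - y n = g (t - n%:R).
  by move=> nt; rewrite min_r// cy// -addrA; apply: subrKC.
exists (fun t => c (Num.min t n%:R) + g (t - n%:R) - y n); split.
- move=> t; apply: cvgB; last exact: cvg_cst.
  by apply: cvgD; [exact: ccmin|exact: cgB].
- by move=> t /=; have [/cL ->|/cR ->] := orP (le_total t n%:R).
- move=> i; rewrite leq_eqVlt ltnS => /predU1P[->|ni].
    by rewrite cR ?ler_nat// g1// -natrB// subSnn.
  by rewrite cL ?ler_nat// cy.
Qed.

Lemma longest_prefix (A : nat -> nat -> Prop) (m : nat) :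
  (forall i, A 0%N i) -> (forall n n' i, (n' <= n)%N -> A n i -> A n' i) ->
  exists i, (i <= m)%N /\
    forall n i', (n <= m)%N -> (i' <= m)%N -> A n i' -> A n i.
Proof.
move=> A0 Amono.
suff H : forall M, exists i, (i <= m)%N /\
    forall n i', (n <= M)%N -> (i' <= m)%N -> A n i' -> A n i.
  exact: (H m).
elim=> [|M [i [im iP]]].
  by exists 0%N; split => // n i'; rewrite leqn0 => /eqP ->.
have [[i' [i'm Ai']]|no] := pselect (exists i', (i' <= m)%N /\ A M.+1 i').
  by exists i'; split => // n i'' nM _ _; exact: Amono nM Ai'.
exists i; split => // n i'; rewrite leq_eqVlt ltnS => /predU1P[->|nM].
  by move=> i'm Ai'; case: no; exists i'.
exact: iP.
Qed.

(** The test [l], coding a pair [(p, k)], compares the distance from [phi] to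
    [y p] with [1 / (k + 1)] and [2 / (k + 1)].  A bit 0 at [l] is a constraint
    on the selected point, namely to be within [3 / (k + 1)] of [y p]; a bit 1 is
    none.  Once the tests up to [l] are settled, the points of the sequence close
    enough to [phi] satisfy the constraints up to [l], so the selected point
    satisfies them too; and for every [k] some [p] makes the constraint [(p, k)]
    effective, which brings the selected point within [4 / (k + 1)] of
    [phi]. *)
Lemma baire_boundary_succ alpha (f phi : R * R -> V) (E : set (R * R)) :
  ord_le ord_one alpha -> separable_set Y -> arcwise_connected R Y ->
  baire_class (@upper_half_plane R) Y alpha f ->
  E `<=` @x_axis R -> set_fun E Y phi -> boundary_function f E phi ->
  baire_class E Y (ord_succ alpha) phi.
Proof.
move=> a1 sY acY bf EX phiY fphi.
have [Y0|nY0] := pselect (Y !=set0); last first.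
  have E0 x : ~ E x by move=> Ex; apply: nY0; exists (phi x); exact: phiY.
  apply: (baire_class_mono (ord_zero_le _)); apply: baire_class0 => //.
  by apply/subspace_continuousP => x /E0.
have [y [Yy yD]] := separable_dense_seq sY Y0.
pose code l : nat * nat := odflt (0%N, 0%N) (unpickle l).
pose pt l := y (code l).1; pose rad l : R := (code l).2.+1%:R^-1.
have rad0 l : 0 < rad l by rewrite invr_gt0.
pose dist l v := `|v - pt l|.
have cdist l : continuous (dist l).
  by move=> v; apply: cvg_norm; apply: cvgB; [exact: cvg_id|exact: cvg_cst].
have sep l : exists g : nat -> R * R -> R,
    [/\ forall n, baire_class setT setT alpha (g n),
        forall n z, g n z = 0 \/ g n z = 1,
        forall z, E z -> dist l (phi z) < rad l -> \forall n \near \oo, g n z = 0 &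
        forall z, E z -> 2 * rad l < dist l (phi z) -> \forall n \near \oo, g n z = 1].
  apply: (boundary_separate (F := dist l \o f) (phi := dist l \o phi)) => //.
  - exact: (baire_class_comp (@cdist l)) bf.
  - move=> x Ex; have [A xA Alim] := fphi x Ex; exists A => //.
    by apply: (@cvg_comp _ _ _ f (dist l)); [exact: Alim|exact: cdist].
  - by rewrite ltr_pMl// ltr1n.
have [G GP] := choice sep.
pose bits m z := [seq G l m z == 1 | l <- iota 0 m].
have bitsE m l z : (l < m)%N -> nth true (bits m z) l = (G l m z == 1).
  by move=> lm; rewrite (nth_map 0%N) ?size_iota// nth_iota.
(* Out of range the default value [true] imposes no constraint. *)
pose fits s N i := forall l, (l < N)%N -> nth true s l = false ->
  dist l (y i) < 3 * rad l.
have sel m s : exists i, (i <= m)%N /\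
    forall N i', (N <= m)%N -> (i' <= m)%N -> fits s N i' -> fits s N i.
  apply: longest_prefix => [i l //|N N' i NN' fi l lN']; apply: fi.
  exact: leq_trans lN' NN'.
pose I m := projT1 (choice (sel m)); pose IP m := projT2 (choice (sel m)).
have [c cP] := choice (fun m => path_through m acY Yy).
pose psi m z := c m (I m (bits m z))%:R.
have psiE m z : psi m z = y (I m (bits m z)).
  by have [_ _] := cP m; apply; have [] := IP m (bits m z).
apply: (@baire_class_lim _ _ _ _ _ _ (fun=> alpha) psi) => //.
- by apply: ord_le_trans a1 _; apply: ord_ltW; exact: ord_lt_sup tt.
- by move=> _; apply/ord_lt_succ; exact: ord_le_refl.
- move=> m; have [cc cY _] := cP m.
  rewrite -[psi m]/(c m \o (fun z => (I m (bits m z))%:R)).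
  apply: (@baire_class_comp _ _ _ _ setT) => //.
  have bI : baire_class setT setT alpha (fun z : R * R => (I m (bits m z))%:R : R).
    apply: (@baire_bits _ _ _ (fun l => G l m) (fun s => (I m s)%:R)).
      by move=> l; have [] := GP l.
    by move=> l; have [] := GP l.
  by apply: (baire_class_precomp (p := id) _ _ bI) => // z; exact: cvg_id.
move=> z Ez; apply/cvgrPdist_lt => e e0.
have e4 : 0 < e / 4 by rewrite divr_gt0.
have [k0 _ k0P] := near_infty_natSinv_lt (PosNum e4).
have {k0P} ke : k0.+1%:R^-1 < e / 4 := k0P k0 (leqnn _).
have [p pP] : exists p, `|phi z - y p| < k0.+1%:R^-1.
  by apply: yD; [exact: phiY|rewrite invr_gt0].
pose l0 := pickle (p, k0).
have codel0 : code l0 = (p, k0) by rewrite /code /l0 pickleK.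
have radl0 : rad l0 = k0.+1%:R^-1 by rewrite /rad codel0.
have [r r0 rP] : exists2 r, 0 < r & forall l, (l < l0.+1)%N -> r <= rad l.
  elim: l0.+1 => [|N [r r0 rP]]; first by exists 1.
  exists (Num.min r (rad N)); first by rewrite lt_min r0 rad0.
  move=> l; rewrite ltnS leq_eqVlt => /predU1P[->|/rP rl]; rewrite ge_min ?lexx ?orbT//.
  by rewrite rl.
have [i0 i0P] := yD (phi z) r (phiY _ Ez) r0.
have settled : \forall m \near \oo, forall l, (l < l0.+1)%N ->
    G l m z = 1 \/ dist l (phi z) <= 2 * rad l.
  apply: near_forall_lt => l _; have [le|gt] := leP (dist l (phi z)) (2 * rad l).
    by near=> m; right.
  have [_ _ _ /(_ _ Ez gt) G1] := GP l.
  by near=> m; left; near: m.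
have near0 : \forall m \near \oo, G l0 m z = 0.
  by have [_ _ + _] := GP l0; apply => //; rewrite radl0 /dist /pt codel0.
near=> m.
have l0m : (l0 < m)%N by near: m; exact: nbhs_infty_gt.
have i0m : (i0 <= m)%N by near: m; exact: nbhs_infty_ge.
have fit0 : fits (bits m z) l0.+1 i0.
  move=> l ll0; rewrite bitsE ?(leq_trans ll0)// => /eqP Gl.
  have dl : dist l (phi z) <= 2 * rad l.
    have : G l m z = 1 \/ dist l (phi z) <= 2 * rad l by move: l ll0 {Gl}; near: m.
    by case.
  have := ler_distD (phi z) (y i0) (pt l); rewrite (distrC (y i0) (phi z)).
  move/le_lt_trans; apply.
  have -> : 3 * rad l = rad l + 2 * rad l by lra.
  by rewrite ltr_leD// (lt_le_trans i0P)// rP.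
have [_ /(_ _ _ l0m i0m fit0) fitI] := IP m (bits m z).
have : dist l0 (y (I m (bits m z))) < 3 * rad l0.
  apply: fitI => //; rewrite bitsE//.
  have -> : G l0 m z = 0 by near: m.
  by rewrite eq_sym oner_eq0.
rewrite radl0 /dist /pt codel0 psiE /= => yI.
have := ler_distD (y p) (phi z) (y (I m (bits m z))); rewrite (distrC (y p)).
move/le_lt_trans; apply.
have -> : e = e / 4 + 3 * (e / 4) by lra.
rewrite ltrD ?(lt_trans pP)// (lt_trans yI)//.
by rewrite ltr_pM2l.
Unshelve. all: by end_near. Qed.

End Approximation.

(* The topology of 'rV[R]_n is the Euclidean one; every notion below depends on
   the metrics of R^2 and R^n only through their topologies. *)
Theorem theorem3p1 (R : realType) (n : nat) (Y : set 'rV[R]_n)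
    (xi : ordinal_number) (f : R * R -> 'rV[R]_n)
    (E : set (R * R)) (phi : R * R -> 'rV[R]_n) :
  (1 <= n)%N ->
  separable_set Y ->
  arcwise_connected R Y ->
  ord_le (ord_succ ord_zero) xi ->
  set_fun (@upper_half_plane R) Y f ->
  baire_class (@upper_half_plane R) Y (ord_addn xi n.-1) f ->
  E `<=` @x_axis R ->
  set_fun E Y phi ->
  boundary_function f E phi ->
  baire_class E Y (ord_addn xi n) phi.
Proof.
case: n Y f phi => [//|n] Y f phi _ sY acY xi1 _ bf EX phiY fphi.
apply: baire_boundary_succ bf EX phiY fphi => //.
by apply: ord_le_trans xi1 _; exact: ord_le_addn.
Qed.
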